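(* Let $R\subseteq T_A$ be a bimodule of relations of a strongly graded connected $S$-ring $A$ such that $R$ and $A^1$ are projective as left $S$-modules, and let $(A\otimes V_*,d_* )$ be a projective resolution of $S$ of the form described in the context. If $D$ is the central extension of $A$ associated to a filtered morphism $\alpha:R\to T_A$, then $z$ is regular in $D$ if and only if either $c_{V_3}=-1$ or $z$ is $c_{V_3}$-regular.
   Context: $S$ is an associative unital ring, $\otimes=\otimes_S$. A positively graded $S$-ring $A=\bigoplus_{n\ge0}A^n$ is connected if $A^0=S$ and strongly graded if $A^nA^m=A^{n+m}$. $T_A:=T_S(A^1)$ is the tensor $S$-ring, $\pi_A:T_A\to A$ the canonical surjection (identity in degrees $0,1$), $I_A=\ker\pi_A$. A bimodule of relations for $A$ is a graded $S$-subbimodule $R$ of $I_A$ with $I_A=R\oplus(A^1I_A+I_AA^1)$. A filtered morphism $\alpha:R\to T_A$ is an $S$-bimodule map with $\alpha(R^n)\subseteq T_A^{\le n}$; $\alpha_i$ is its component of degree $-i$ (on $R^n$ it is $\alpha$ followed by projection to $T_A^{n-i}$); by convention $\alpha_0$ is the inclusion. The central extension associated to $\alpha$ is $D:=T_A[z]/\langle\alpha_z(R)\rangle$, where $z$ is a central variable of degree $1$ and $\alpha_z(r)=\sum_{i\ge0}\alpha_i(r)z^i$. The class of $z$ in $D$ is again denoted $z$. It is $n$-regular if $\operatorname{ann}(z)\cap D^{\le n}=0$, where $\operatorname{ann}(z)=\{a\in D\mid za=0\}$; it is regular if $\operatorname{ann}(z)=0$ ($\infty$-regular means regular). Resolution: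 a projective resolution of the left $A$-module $S$ $$\cdots\to A\otimes V_n\xrightarrow{d_n}\cdots\to A\otimes V_2\xrightarrow{d_2}A\otimes A^1\xrightarrow{d_1}A\xrightarrow{d_0}S\to0$$ with $V_n$ graded projective left $S$-modules, $d_n$ graded $A$-linear, $d_0$ the projection onto $A^0=S$, $d_1$ induced by multiplication, and $V_n^i=0$ for $n\ge2$, $i=0,1$. The complexity $c_V$ of a graded left $S$-module $V$ is $-1$ if $V=0$ and $\sup\{n-1\mid V^n\ne0\}$ otherwise (possibly $\infty$). *)

(* Defs.v *)
From HB Require Import structures.
From mathcomp Require Import all_boot all_algebra generic_quotient ring_quotient.
From mathcomp Require Import boolp classical_sets constructive_ereal.
From mathcomp Require Import freeg.

Set Implicit Arguments.
Unset Strict Implicit.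
Unset Printing Implicit Defensive.

Import GRing.Theory.
Local Open Scope ring_scope.
Local Open Scope classical_set_scope.
Local Open Scope quotient_scope.

(* The additive subgroup generated by X. *)
Inductive span (M : zmodType) (X : set M) : set M :=
| span_gen x : X x -> span X x
| span_0 : span X 0
| span_B x y : span X x -> span X y -> span X (x - y).

Section SpanQuotient.
Variables (M : zmodType) (X : set M).

Definition spanb : {pred M} := fun x => `[< span X x >].

Lemma spanb_zmod : zmod_closed spanb.
Proof.
split=> [|x y /asboolP xX /asboolP yX]; apply/asboolP; first exact: span_0.
exact: span_B.
Qed.

HB.instance Definition _ := GRing.isZmodClosed.Build M spanb spanb_zmod.

Definition span_quot : Type := Quotient.quot spanb.
HB.instance Definition _ := GRing.Zmodule.on span_quot.
HB.instance Definition _ : EqQuotient M (Quotient.equiv spanb) span_quot :=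
  EqQuotient.on span_quot.
HB.instance Definition _ := @isZmodQuotient.Build M (Quotient.equiv spanb) 0
  -%R +%R span_quot (lock _) (@Quotient.pi_opp M spanb)
  (@Quotient.pi_add M spanb).

Definition span_pi : M -> span_quot := \pi_span_quot.
HB.instance Definition _ := GRing.Additive.on span_pi.

Lemma span_pi_eq (x y : M) : span X (x - y) <-> span_pi x = span_pi y.
Proof.
split=> [xy|/eqP]; first by apply/eqP; rewrite -Quotient.idealrBE; apply/asboolP.
by rewrite -Quotient.idealrBE => /asboolP.
Qed.

End SpanQuotient.

Record submod (S : nzRingType) (M : lmodType S) := Submod {
  submod_set :> M -> Prop;
  submod_0 : submod_set 0;
  submod_lin : forall a x y,
    submod_set x -> submod_set y -> submod_set (a *: x + y) }.

Section SubmodType.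
Variables (S : nzRingType) (M : lmodType S) (U : submod M).

Definition in_submod : {pred M} := fun x => `[< U x >].

Lemma in_submod_closed : submod_closed in_submod.
Proof.
split=> [|a x y /asboolP xU /asboolP yU]; apply/asboolP; first exact: submod_0.
exact: submod_lin.
Qed.

HB.instance Definition _ :=
  GRing.isSubmodClosed.Build S M in_submod in_submod_closed.

Record sub_of : Type := SubOf { sub_val :> M; sub_valP : sub_val \in in_submod }.

HB.instance Definition _ := [isSub for sub_val].
HB.instance Definition _ := [Choice of sub_of by <:].
HB.instance Definition _ := [SubChoice_isSubLmodule of sub_of by <:].

End SubmodType.

Definition projective (S : nzRingType) (P : lmodType S) : Prop :=
  forall (M N : lmodType S) (g : {linear M -> N}) (f : {linear P -> N}),
    (forall y, exists x, g x = y) ->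
  exists h : {linear P -> M}, forall p, g (h p) = f p.

Record bimod (E S : nzRingType) := Bimod {
  bimod_left :> lmodType E;
  ract : bimod_left -> S -> bimod_left;
  ractDl : forall b c s, ract (b + c) s = ract b s + ract c s;
  ractDr : forall b s t, ract b (s + t) = ract b s + ract b t;
  ractA : forall b s t, ract b (s * t) = ract (ract b s) t;
  ract1 : forall b, ract b 1 = b;
  ractZ : forall e b s, ract (e *: b) s = e *: ract b s }.

Section Tensor.
Variables (E S : nzRingType) (B : bimod E S) (M : lmodType S).

Local Notation F := {freeg (B * M) / int}.
Local Notation "<[ b , m ]>" := (<< (b, m) >> : F).

Inductive tens_rel : set F :=
| tens_relDl b c m : tens_rel (<[ b + c, m ]> - (<[ b, m ]> + <[ c, m ]>))
| tens_relDr b m n : tens_rel (<[ b, m + n ]> - (<[ b, m ]> + <[ b, n ]>))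
| tens_relS b s m : tens_rel (<[ ract b s, m ]> - <[ b, s *: m ]>).

Definition tens : Type := span_quot tens_rel.
HB.instance Definition _ := GRing.Zmodule.on tens.

Definition pure (b : B) (m : M) : tens := span_pi tens_rel <[ b, m ]>.

Definition balanced (G : zmodType) (f : B -> M -> G) : Prop :=
  [/\ forall b c m, f (b + c) m = f b m + f c m,
      forall b m n, f b (m + n) = f b m + f b n
    & forall b s m, f (ract b s) m = f b (s *: m)].

(* The additive map on the tensor product induced by f; meaningful when f is
   balanced. *)
Definition tlift (G : zmodType) (f : B -> M -> G) (t : tens) : G :=
  fglift (fun p => f p.1 p.2 : zmodule G) (repr (t : span_quot tens_rel)).

Lemma pureDl b c m : pure (b + c) m = pure b m + pure c m.
Proof.
by rewrite /pure -raddfD; apply/span_pi_eq/span_gen/tens_relDl.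
Qed.

Lemma pureDr b m n : pure b (m + n) = pure b m + pure b n.
Proof.
by rewrite /pure -raddfD; apply/span_pi_eq/span_gen/tens_relDr.
Qed.

Lemma pure_ract b s m : pure (ract b s) m = pure b (s *: m).
Proof. by apply/span_pi_eq/span_gen/tens_relS. Qed.

Lemma pure_balanced : balanced pure.
Proof. by split; [exact: pureDl|exact: pureDr|exact: pure_ract]. Qed.

Section Lift.
Variables (G : zmodType) (f : B -> M -> G).
Hypothesis fb : balanced f.

Let fF : F -> G := fglift (fun p => f p.1 p.2 : zmodule G).

Let fFB (x y : F) : fF (x - y) = fF x - fF y.
Proof. exact: (lift_is_additive (fun p => f p.1 p.2 : zmodule G) x y). Qed.

Let fF0 : fF 0 = 0.
Proof. by have := fFB 0 0; rewrite !subrr. Qed.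

Let fFD (x y : F) : fF (x + y) = fF x + fF y.
Proof.
have fFN : fF (- y) = - fF y by have := fFB 0 y; rewrite !sub0r fF0 sub0r.
by have := fFB x (- y); rewrite fFN !opprK.
Qed.

Let fFU b m : fF <[ b, m ]> = f b m.
Proof. by rewrite /fF liftU scale1r. Qed.

Let fF_span (x : F) : span tens_rel x -> fF x = 0.
Proof.
case: fb => fDl fDr fS.
elim=> [{}x [b c m|b m n|b s m]||{}x y _ x0 _ y0]; rewrite ?fFB ?fFD ?fFU.
- by rewrite fDl subrr.
- by rewrite fDr subrr.
- by rewrite fS subrr.
- exact: fF0.
- by rewrite x0 y0 subr0.
Qed.

Let tlift_pi (x : F) : tlift f (span_pi tens_rel x) = fF x.
Proof.
apply/eqP; rewrite -subr_eq0; apply/eqP.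
rewrite /tlift -/(fF _) -fFB; apply: fF_span; apply/span_pi_eq.
by rewrite /span_pi reprK.
Qed.

Lemma tlift_pure b m : tlift f (pure b m) = f b m.
Proof. by rewrite /pure tlift_pi fFU. Qed.

Lemma tliftB x y : tlift f (x - y) = tlift f x - tlift f y.
Proof.
elim/quotW: x => x; elim/quotW: y => y.
by rewrite -raddfB !tlift_pi fFB.
Qed.

Lemma tlift0 : tlift f 0 = 0.
Proof. by have := tliftB 0 0; rewrite !subrr. Qed.

Lemma tliftN x : tlift f (- x) = - tlift f x.
Proof. by have := tliftB 0 x; rewrite tlift0 !sub0r. Qed.

Lemma tliftD x y : tlift f (x + y) = tlift f x + tlift f y.
Proof. by have := tliftB x (- y); rewrite tliftN !opprK. Qed.

End Lift.

Lemma tens_ind (P : tens -> Prop) :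
  P 0 -> (forall x y, P x -> P y -> P (x - y)) ->
  (forall b m, P (pure b m)) -> forall t, P t.
Proof.
move=> P0 PB Pp; have PN x : P x -> P (- x) by rewrite -sub0r; exact: PB.
have PD x y : P x -> P y -> P (x + y).
  by move=> Px Py; rewrite -[y]opprK; apply: PB => //; exact: PN.
elim/quotW => x; rewrite -[x]freeg_sumE raddf_sum.
apply: (big_ind P) => // -[b m] _.
set k := coeff _ _; have -> : << k *g (b, m) >> = <[ b, m ]> *~ k :> F.
  by rewrite freegU_mulz intz.
rewrite raddfMz -/(pure b m).
have PMn n : P (pure b m *+ n).
  by elim: n => [|n IH]; rewrite ?mulr0n // mulrS; apply: PD.
by case: k => n; [exact: PMn | rewrite NegzE mulrNz; apply/PN/PMn].
Qed.

Definition tens_scale (e : E) : tens -> tens :=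
  tlift (fun b m => pure (e *: b) m).

Lemma tens_scale_balanced e : balanced (fun b m => pure (e *: b) m).
Proof.
split=> *; first by rewrite scalerDr pureDl.
- by rewrite pureDr.
- by rewrite -ractZ pure_ract.
Qed.

Let scU e b m : tens_scale e (pure b m) = pure (e *: b) m.
Proof. exact/tlift_pure/tens_scale_balanced. Qed.

Let scB e x y : tens_scale e (x - y) = tens_scale e x - tens_scale e y.
Proof. exact/tliftB/tens_scale_balanced. Qed.

Let sc0 e : tens_scale e 0 = 0.
Proof. exact/tlift0/tens_scale_balanced. Qed.

Lemma tens_scaleA a b t :
  tens_scale a (tens_scale b t) = tens_scale (a * b) t.
Proof.
elim/tens_ind: t => [|x y IHx IHy|c m]; first by rewrite !sc0.
  by rewrite !scB IHx IHy.
by rewrite !scU scalerA.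
Qed.

Lemma tens_scale1 : left_id 1 tens_scale.
Proof.
move=> t; elim/tens_ind: t => [|x y IHx IHy|c m]; first by rewrite !sc0.
  by rewrite !scB IHx IHy.
by rewrite !scU scale1r.
Qed.

Lemma tens_scaleDr : right_distributive tens_scale +%R.
Proof. by move=> e x y; exact/tliftD/tens_scale_balanced. Qed.

Lemma tens_scaleDl t : {morph tens_scale^~ t : a b / a + b}.
Proof.
move=> a b; elim/tens_ind: t => [|x y IHx IHy|c m].
- by rewrite !sc0 addr0.
- by rewrite !scB IHx IHy opprD addrACA.
- by rewrite !scU scalerDl pureDl.
Qed.

HB.instance Definition _ := GRing.Zmodule_isLmodule.Build E tens
  tens_scaleA tens_scale1 tens_scaleDr tens_scaleDl.

Lemma tens_scale_pure e b m : e *: pure b m = pure (e *: b) m.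
Proof. exact: scU. Qed.

End Tensor.

(* The tensor ring T_S(V), as the direct sum of the tensor powers of V: an
   element is the finitely supported family of its homogeneous components.
   The tensor powers are V (x) (V (x) ... (x) (V (x) S)), with S in degree 0. *)
Section TensorRing.
Variables (S : nzRingType) (V : bimod S S).

Fixpoint tpow (n : nat) : lmodType S :=
  match n with
  | 0 => (S^o : lmodType S)
  | n'.+1 => (tens V (tpow n') : lmodType S)
  end.

Record tring : Type := Tring {
  tfun :> forall n, tpow n;
  tfun_fin : exists N, forall n, (N <= n)%N -> tfun n = 0 }.

Lemma tringP (t u : tring) : (forall n, t n = u n) -> t = u.
Proof.
case: t u => t tP [u uP] /= tu; have {}tu := functional_extensionality_dep tu.
by case: u / tu uP => uP; congr Tring; exact: Prop_irrelevance.
Qed.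

HB.instance Definition _ := gen_eqMixin tring.
HB.instance Definition _ := gen_choiceMixin tring.

Program Definition tzero : tring := @Tring (fun=> 0) _.
Next Obligation. by exists 0%N. Qed.

Program Definition topp (t : tring) : tring := @Tring (fun n => - t n) _.
Next Obligation.
by have [N tN] := tfun_fin t; exists N => n Nn; rewrite tN ?oppr0.
Qed.

Program Definition tadd (t u : tring) : tring := @Tring (fun n => t n + u n) _.
Next Obligation.
have [N tN] := tfun_fin t; have [K uK] := tfun_fin u.
exists (maxn N K) => n; rewrite geq_max => /andP[Nn Kn].
by rewrite tN ?uK ?addr0.
Qed.

Program Definition tscale (s : S) (t : tring) : tring :=
  @Tring (fun n => s *: t n) _.
Next Obligation.
by have [N tN] := tfun_fin t; exists N => n Nn; rewrite tN ?scaler0.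
Qed.

Lemma taddA : associative tadd.
Proof. by move=> t u v; apply: tringP => n /=; rewrite addrA. Qed.
Lemma taddC : commutative tadd.
Proof. by move=> t u; apply: tringP => n /=; rewrite addrC. Qed.
Lemma tadd0 : left_id tzero tadd.
Proof. by move=> t; apply: tringP => n /=; rewrite add0r. Qed.
Lemma taddN : left_inverse tzero topp tadd.
Proof. by move=> t; apply: tringP => n /=; rewrite addNr. Qed.

HB.instance Definition _ := GRing.isZmodule.Build tring taddA taddC tadd0 taddN.

Lemma tscaleA a b t : tscale a (tscale b t) = tscale (a * b) t.
Proof. by apply: tringP => n /=; rewrite scalerA. Qed.
Lemma tscale1 : left_id 1 tscale.
Proof. by move=> t; apply: tringP => n /=; rewrite scale1r. Qed.
Lemma tscaleDr : right_distributive tscale +%R.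
Proof. by move=> a t u; apply: tringP => n /=; rewrite scalerDr. Qed.
Lemma tscaleDl t : {morph tscale^~ t : a b / a + b}.
Proof. by move=> a b; apply: tringP => n /=; rewrite scalerDl. Qed.

HB.instance Definition _ := GRing.Zmodule_isLmodule.Build S tring
  tscaleA tscale1 tscaleDr tscaleDl.

Lemma tfunD t u n : (t + u : tring) n = t n + u n. Proof. by []. Qed.
Lemma tfunN t n : (- t : tring) n = - t n. Proof. by []. Qed.
Lemma tfun0 n : (0 : tring) n = 0. Proof. by []. Qed.
Lemma tfunZ s t n : (s *: t : tring) n = s *: t n. Proof. by []. Qed.

(* One more than the degree of t; 0 for t = 0. *)
Lemma tsize_ex (t : tring) :
  exists N, `[< forall n, (N <= n)%N -> t n = 0 >].
Proof. by have [N tN] := tfun_fin t; exists N; apply/asboolP. Qed.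

Definition tsize (t : tring) : nat := ex_minn (tsize_ex t).

Lemma tsizeP t n : (tsize t <= n)%N -> t n = 0.
Proof. by rewrite /tsize; case: ex_minnP => N /asboolP tN _; exact: tN. Qed.

(* Left multiplication by v in V = T^1. *)
Program Definition vmul (v : V) (t : tring) : tring :=
  @Tring (fun n => match n with 0 => 0 | n'.+1 => pure v (t n') end) _.
Next Obligation.
have [N tN] := tfun_fin t; exists N.+1 => -[//|n] Nn; rewrite tN //.
by have := pureDr v 0 (0 : tpow n); rewrite addr0 => /esym/(canRL (addrK _)); rewrite subrr.
Qed.

Lemma vmulDl v w t : vmul (v + w) t = vmul v t + vmul w t.
Proof. by apply: tringP => -[|n] /=; rewrite ?tfunD /= ?addr0 // pureDl. Qed.

Lemma vmulDr v t u : vmul v (t + u) = vmul v t + vmul v u.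
Proof. by apply: tringP => -[|n] /=; rewrite ?tfunD /= ?addr0 // pureDr. Qed.

Lemma vmulZ s v t : vmul (s *: v) t = s *: vmul v t.
Proof.
by apply: tringP => -[|n] /=; rewrite ?tfunZ /= ?scaler0 // tens_scale_pure.
Qed.

Lemma vmul_ract v s t : vmul (ract v s) t = vmul v (s *: t).
Proof. by apply: tringP => -[|n] //=; rewrite pure_ract. Qed.

(* Left multiplication by a homogeneous element of degree n:
   (v_1 (x) ... (x) v_n) t = v_1 (v_2 (... (v_n t))). *)
Fixpoint tact (n : nat) : tpow n -> tring -> tring :=
  match n with
  | 0 => fun s t => (s : S) *: t
  | n'.+1 => fun x t => tlift (fun v y => vmul v (@tact n' y t)) x
  end.

Lemma vmul0 v : vmul v 0 = 0.
Proof. by have := vmulDr v 0 0; rewrite addr0 => /esym/(canRL (addrK _)); rewrite subrr. Qed.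

Lemma vmulB v t u : vmul v (t - u) = vmul v t - vmul v u.
Proof.
apply/eqP; rewrite eq_sym subr_eq -vmulDr; apply/eqP; congr vmul.
by rewrite subrK.
Qed.

Lemma tact_spec n :
  [/\ forall (x y : tpow n) t, tact (x + y) t = tact x t + tact y t,
      forall s (x : tpow n) t, tact (s *: x) t = s *: tact x t
    & forall t, balanced (fun (v : V) (y : tpow n) => vmul v (tact y t))].
Proof.
elim: n => [|n [IHD IHZ IHb]].
  have D (x y : tpow 0) t : tact (x + y) t = tact x t + tact y t.
    exact: scalerDl.
  have Z s (x : tpow 0) t : tact (s *: x) t = s *: tact x t.
    by rewrite /= scalerA.
  split=> // t; split=> *; first by rewrite vmulDl.
    by rewrite D vmulDr.
  by rewrite Z vmul_ract.
have D (x y : tpow n.+1) t : tact (x + y) t = tact x t + tact y t.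
  exact: tliftD.
have T0 t : tact (0 : tpow n.+1) t = 0 by exact: tlift0.
have TB (x y : tpow n.+1) t : tact (x - y) t = tact x t - tact y t.
  exact: tliftB.
have TP v y t : tact (pure v y : tpow n.+1) t = vmul v (tact y t).
  exact: (tlift_pure (IHb t)).
have Z s (x : tpow n.+1) t : tact (s *: x) t = s *: tact x t.
  elim/tens_ind: x => [|x y IHx IHy|v y]; first by rewrite scaler0 T0 scaler0.
    by rewrite scalerBr !TB scalerBr IHx IHy.
  by rewrite tens_scale_pure !TP vmulZ.
split=> // t; split=> *; first by rewrite vmulDl.
  by rewrite D vmulDr.
by rewrite Z vmul_ract.
Qed.

Lemma tactDl n (x y : tpow n) t : tact (x + y) t = tact x t + tact y t.
Proof. by case: (tact_spec n). Qed.
Lemma tactZ n s (x : tpow n) t : tact (s *: x) t = s *: tact x t.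
Proof. by case: (tact_spec n). Qed.
Lemma tact_balanced n t :
  balanced (fun (v : V) (y : tpow n) => vmul v (tact y t)).
Proof. by case: (tact_spec n). Qed.
Lemma tact0 n t : tact (0 : tpow n) t = 0.
Proof. by rewrite -(scale0r (0 : tpow n)) tactZ scale0r. Qed.
Lemma tact_pure n v (y : tpow n) t :
  tact (pure v y : tpow n.+1) t = vmul v (tact y t).
Proof. exact/tlift_pure/tact_balanced. Qed.
Lemma tactBl n (x y : tpow n) t : tact (x - y) t = tact x t - tact y t.
Proof. by rewrite tactDl -scaleN1r tactZ scaleN1r. Qed.

Lemma tactDr n (x : tpow n) t u : tact x (t + u) = tact x t + tact x u.
Proof.
elim: n x => [|n IH] x; first exact: scalerDr.
elim/tens_ind: x => [|x y IHx IHy|v y]; first by rewrite !tact0 addr0.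
  by rewrite !tactBl IHx IHy opprD addrACA.
by rewrite !tact_pure IH vmulDr.
Qed.

Definition tmul (t u : tring) : tring := \sum_(n < tsize t) tact (t n) u.

Program Definition tone : tring :=
  @Tring (fun n => match n with 0 => (1 : S) | n'.+1 => 0 end) _.
Next Obligation. by exists 1%N => -[]. Qed.

Lemma tmulE N (t u : tring) : (forall n, (N <= n)%N -> t n = 0) ->
  tmul t u = \sum_(n < N) tact (t n) u.
Proof.
move=> tN; have aux K L : (K <= L)%N -> (forall n, (K <= n)%N -> t n = 0) ->
    \sum_(n < K) tact (t n) u = \sum_(n < L) tact (t n) u.
  move=> KL tK; rewrite (big_ord_widen L (fun n => tact (t n) u)) //.
  rewrite [RHS](bigID (fun i : 'I_L => (i < K)%N)) /= [X in _ + X]big1 ?addr0 //.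
  by move=> i; rewrite -leqNgt => /tK ->; rewrite tact0.
have [le|/ltnW le] := leqP (tsize t) N; first by apply: aux => // n /tsizeP.
by apply/esym/aux.
Qed.

Lemma tmulDl : left_distributive tmul +%R.
Proof.
move=> t u w; set N := maxn (tsize t) (tsize u).
have tN n : (N <= n)%N -> t n = 0.
  by rewrite geq_max => /andP[/tsizeP].
have uN n : (N <= n)%N -> u n = 0.
  by rewrite geq_max => /andP[_ /tsizeP].
rewrite (tmulE _ tN) (tmulE _ uN) (@tmulE N) -?big_split /=.
  by apply: eq_bigr => i _; rewrite -tactDl.
by move=> n Nn; rewrite tN // uN // addr0.
Qed.

Lemma tmulDr : right_distributive tmul +%R.
Proof.
move=> t u w; rewrite /tmul -big_split /=.
by apply: eq_bigr => i _; rewrite tactDr.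
Qed.

Lemma tmulZ s t u : s *: tmul t u = tmul (s *: t) u.
Proof.
rewrite (@tmulE (tsize t) (s *: t)).
  by rewrite scaler_sumr; apply: eq_bigr => i _; rewrite -tactZ.
by move=> n /tsizeP tn; rewrite tfunZ tn scaler0.
Qed.

Lemma vmul_sum v (I : Type) (r : seq I) (P : pred I) F :
  vmul v (\sum_(i <- r | P i) F i) = \sum_(i <- r | P i) vmul v (F i).
Proof. exact: (big_morph _ (vmulDr v) (vmul0 v)). Qed.

Lemma vmul_tmul v t u : tmul (vmul v t) u = vmul v (tmul t u).
Proof.
rewrite (@tmulE (tsize t).+1) => [|[//|n] tn /=]; last first.
  have -> : t n = 0 by exact: tsizeP.
  by have := vmul0 v => /(congr1 (fun t : tring => t n.+1)).
rewrite big_ord_recl tact0 add0r /tmul vmul_sum.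
by apply: eq_bigr => i _; rewrite -tact_pure.
Qed.

Lemma tmul0l t : tmul 0 t = 0.
Proof. by rewrite (@tmulE 0) ?big_ord0. Qed.

Lemma tmulBl t u w : tmul (t - u) w = tmul t w - tmul u w.
Proof. by rewrite tmulDl -scaleN1r -tmulZ scaleN1r. Qed.

Lemma tact_tmul n (x : tpow n) t u : tact x (tmul t u) = tmul (tact x t) u.
Proof.
elim: n x => [|n IH] x; first exact: tmulZ.
elim/tens_ind: x => [|x y IHx IHy|v y]; first by rewrite !tact0 tmul0l.
  by rewrite !tactBl tmulBl IHx IHy.
by rewrite !tact_pure IH vmul_tmul.
Qed.

Lemma tmulA : associative tmul.
Proof.
move=> t u w; rewrite {1 4}/tmul.
rewrite (big_morph (tmul^~ w) (fun a b => tmulDl a b w) (tmul0l w)).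
by apply: eq_bigr => i _; rewrite tact_tmul.
Qed.

Lemma tmul1 : left_id tone tmul.
Proof. by move=> t; rewrite (@tmulE 1) ?big_ord1 /= ?scale1r // => -[]. Qed.

Lemma tact_tone n (x : tpow n) :
  (tact x tone) n = x /\ forall m, m != n -> (tact x tone) m = 0.
Proof.
elim: n x => [|n IH] x.
  split=> [|[|m] //]; first exact: mulr1.
  by move=> _; exact: scaler0.
elim/tens_ind: x => [|x y [IHx IHx'] [IHy IHy']|v y].
- by rewrite tact0.
- rewrite tactBl; split=> [|m mn]; rewrite tfunD tfunN ?IHx ?IHy //.
  by rewrite IHx' // IHy' // subr0.
- rewrite tact_pure; have [IH1 IH2] := IH y.
  split=> [|[|m] mn] //=; first by rewrite IH1.
  rewrite IH2 //; have := vmul0 v => /(congr1 (fun t : tring => t m.+1)).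
  by [].
Qed.

Lemma tmulr1 : right_id tone tmul.
Proof.
move=> t; apply: tringP => m.
have sumE N (F : 'I_N -> tring) : (\sum_i F i) m = \sum_i F i m.
  by apply: (big_morph (fun t : tring => t m)).
rewrite /tmul sumE; have [mt|tm] := ltnP m (tsize t).
  rewrite (bigD1 (Ordinal mt)) //= (tact_tone _).1 big1 ?addr0 // => i im.
  by apply: (tact_tone _).2; rewrite eq_sym.
rewrite (tsizeP tm) big1 // => i _; apply: (tact_tone _).2.
by rewrite gtn_eqF // (leq_trans _ tm).
Qed.

Lemma tone_neq0 : tone != 0.
Proof.
apply/eqP => /(congr1 (fun t : tring => t 0%N)) /= /eqP.
by rewrite (negPf (oner_neq0 _)).
Qed.

HB.instance Definition _ := GRing.Zmodule_isNzRing.Build tring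
  tmulA tmul1 tmulr1 tmulDl tmulDr tone_neq0.
HB.instance Definition _ := GRing.Lmodule_isLalgebra.Build S tring tmulZ.

End TensorRing.

Section TensorDegrees.
Variables (S : nzRingType) (V : bimod S S).

(* The homogeneous component of degree n. *)
Program Definition thom (n : nat) (t : tring V) : tring V :=
  @Tring _ _ (fun m => if m == n then t m else 0) _.
Next Obligation.
by have [N tN] := tfun_fin t; exists N => m Nm; rewrite tN ?if_same.
Qed.

Definition tdeg (n : nat) : set (tring V) :=
  [set t | forall m, m != n -> t m = 0].
Definition tdeg_le (n : nat) : set (tring V) :=
  [set t | forall m, (n < m)%N -> t m = 0].

End TensorDegrees.

Definition decomposes (S : nzRingType) (M : lmodType S) (G : nat -> submod M)
    (x : M) (f : nat -> M) : Prop :=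
  (forall n, G n (f n)) /\
  exists N, (forall n, (N <= n)%N -> f n = 0) /\ x = \sum_(n < N) f n.

Definition is_grading (S : nzRingType) (M : lmodType S)
    (G : nat -> submod M) : Prop :=
  forall x, exists! f, decomposes G x f.

Record grmod (S : nzRingType) := GrMod {
  grmod_mod :> lmodType S;
  grmod_deg : nat -> submod grmod_mod;
  grmod_grading : is_grading grmod_deg }.

(* Connected graded S-rings. The S-ring structure is the lalgType structure:
   its structure map is s |-> s%:A, and a right multiplication by s is
   a * s%:A. *)
Record conn_ring (S : nzRingType) := ConnRing {
  conn_alg :> lalgType S;
  conn_deg : nat -> submod conn_alg;
  conn_grading : is_grading conn_deg;
  conn_degM : forall m n x y,
    conn_deg m x -> conn_deg n y -> conn_deg (m + n) (x * y);
  conn_deg0 : forall x, conn_deg 0 x <-> exists s : S, x = s%:A;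
  conn_inj : injective (fun s : S => s%:A : conn_alg) }.

Definition strongly_graded (S : nzRingType) (A : conn_ring S) : Prop :=
  forall m n, conn_deg A (m + n) =
    span [set z : A | exists x y, [/\ conn_deg A m x, conn_deg A n y & z = x * y]]
    :> set A.

Section ConnectedRing.
Variables (S : nzRingType) (A : conn_ring S).

Definition conn_comp (a : A) (n : nat) : A := projT1 (cid (conn_grading a)) n.

Lemma scalarM (s t : S) : (s * t)%:A = s%:A * t%:A :> A.
Proof. by rewrite -scalerAl mul1r scalerA. Qed.

Definition conn_bimod : bimod A S.
Proof.
apply: (@Bimod A S A^o (fun a s => (a : A) * s%:A)).
- by move=> b c s; rewrite mulrDl.
- by move=> b s t; rewrite scalerDl mulrDr.
- by move=> b s t; rewrite scalarM mulrA.
- by move=> b; rewrite scale1r mulr1.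
- by move=> e b s; rewrite /GRing.scale /= mulrA.
Defined.

Lemma deg1_ract (x : sub_of (conn_deg A 1)) (s : S) :
  sub_val x * s%:A \in in_submod (conn_deg A 1).
Proof.
apply/asboolP; apply: (@conn_degM _ A 1 0).
  by case: x => x /= /asboolP.
by apply/conn_deg0; exists s.
Qed.

Definition deg1 : bimod S S.
Proof.
apply: (@Bimod S S (sub_of (conn_deg A 1)) (fun x s => SubOf (deg1_ract x s))).
- by move=> b c s; apply: val_inj; rewrite /= mulrDl.
- by move=> b s t; apply: val_inj; rewrite /= scalerDl mulrDr.
- by move=> b s t; apply: val_inj; rewrite /= scalarM mulrA.
- by move=> b; apply: val_inj; rewrite /= scale1r mulr1.
- by move=> e b s; apply: val_inj; rewrite /= scalerAl.
Defined.

Definition deg1_val (x : deg1) : A := sub_val (x : sub_of (conn_deg A 1)).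

Definition tA : lalgType S := tring deg1.

Fixpoint pi_pow (n : nat) : tpow deg1 n -> A :=
  match n with
  | 0 => fun s => (s : S)%:A
  | n'.+1 => tlift (fun x y => deg1_val x * @pi_pow n' y)
  end.

Definition piA (t : tA) : A := \sum_(n < tsize t) pi_pow (t n).

Definition IA : set tA := [set t | piA t = 0].

(* A^1 I_A + I_A A^1, where A^1 is the degree 1 part of T_A. *)
Definition IA_dec : set tA :=
  span [set w | exists x u,
    [/\ tdeg 1 x, IA u & w = x * u \/ w = u * x]].

Definition relation_bimodule (R : submod tA) : Prop :=
  [/\ forall r (s : S), R r -> R (r * s%:A),
      forall r n, R r -> R (thom n r),
      forall u, IA u <-> exists r w, [/\ R r, IA_dec w & u = r + w]
    & forall u, R u -> IA_dec u -> u = 0].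

(* A filtered morphism R -> T_A is given by a function on T_A of which only the
   values on R matter. *)
Definition filtered_morphism (R : submod tA) (alpha : tA -> tA) : Prop :=
  [/\ forall s r r', R r -> R r' ->
        alpha (s *: r + r') = s *: alpha r + alpha r',
      forall r (s : S), R r -> alpha (r * s%:A) = alpha r * s%:A
    & forall n r, R r -> tdeg n r -> tdeg_le n (alpha r)].

(* alpha_0 is the inclusion by convention, whatever the degree 0 component of
   alpha. For i > 0, r is split into its components thom n r, on which alpha_i
   is alpha followed by the projection to T_A^{n-i}. *)
Definition alpha_comp (alpha : tA -> tA) (i : nat) (r : tA) : tA :=
  if i is 0 then r
  else \sum_(n < tsize r | (i <= n)%N) thom (n - i) (alpha (thom n r)).

(* The components alpha_i with i >= tsize r vanish at r. *)
Definition alpha_z (alpha : tA -> tA) (r : tA) : {poly tA} :=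
  \poly_(i < tsize r) alpha_comp alpha i r.

End ConnectedRing.

Section RingQuotient.
Variables (P : nzRingType) (X : set P).

(* The two-sided ideal generated by X is span ideal_gens. *)
Definition ideal_gens : set P :=
  [set y | exists p x q, X x /\ y = p * x * q].

Lemma ideal_mull p x : span ideal_gens x -> span ideal_gens (p * x).
Proof.
elim=> [{}x [a [y [b [Xy ->]]]]||{}x y _ IHx _ IHy].
- by apply: span_gen; exists (p * a), y, b; rewrite !mulrA.
- by rewrite mulr0; exact: span_0.
- by rewrite mulrBr; exact: span_B.
Qed.

Lemma ideal_mulr x p : span ideal_gens x -> span ideal_gens (x * p).
Proof.
elim=> [{}x [a [y [b [Xy ->]]]]||{}x y _ IHx _ IHy].
- by apply: span_gen; exists a, y, (b * p); rewrite !mulrA.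
- by rewrite mul0r; exact: span_0.
- by rewrite mulrBl; exact: span_B.
Qed.

Definition ring_quot : Type := span_quot ideal_gens.
HB.instance Definition _ := GRing.Zmodule.on ring_quot.

Definition ring_pi : P -> ring_quot := span_pi ideal_gens.

Definition quot_mul (a b : ring_quot) : ring_quot :=
  ring_pi (repr (a : span_quot ideal_gens) * repr (b : span_quot ideal_gens)).

Lemma quot_mul_pi x y : quot_mul (ring_pi x) (ring_pi y) = ring_pi (x * y).
Proof.
apply/span_pi_eq; set x' := repr _; set y' := repr _.
have xx : span ideal_gens (x' - x) by apply/span_pi_eq; rewrite /span_pi reprK.
have yy : span ideal_gens (y' - y) by apply/span_pi_eq; rewrite /span_pi reprK.
have -> : x' * y' - x * y = x' * (y' - y) - (x' - x) * (- y).
  by rewrite mulrN opprK mulrBr mulrBl addrA subrK.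
by apply: span_B; [exact: ideal_mull | exact: ideal_mulr].
Qed.

Lemma ring_quot_ind (Q : ring_quot -> Prop) :
  (forall x, Q (ring_pi x)) -> forall a, Q a.
Proof. by move=> Qx; elim/quotW. Qed.

Lemma ring_piD x y : ring_pi (x + y) = ring_pi x + ring_pi y.
Proof. exact: raddfD. Qed.

Lemma quot_mulA : associative quot_mul.
Proof.
elim/ring_quot_ind => x; elim/ring_quot_ind => y; elim/ring_quot_ind => z.
by rewrite !quot_mul_pi mulrA.
Qed.
Lemma quot_mul1 : left_id (ring_pi 1) quot_mul.
Proof. by elim/ring_quot_ind => x; rewrite quot_mul_pi mul1r. Qed.
Lemma quot_mulr1 : right_id (ring_pi 1) quot_mul.
Proof. by elim/ring_quot_ind => x; rewrite quot_mul_pi mulr1. Qed.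
Lemma quot_mulDl : left_distributive quot_mul +%R.
Proof.
elim/ring_quot_ind => x; elim/ring_quot_ind => y; elim/ring_quot_ind => z.
by rewrite -ring_piD !quot_mul_pi -ring_piD mulrDl.
Qed.
Lemma quot_mulDr : right_distributive quot_mul +%R.
Proof.
elim/ring_quot_ind => x; elim/ring_quot_ind => y; elim/ring_quot_ind => z.
by rewrite -ring_piD !quot_mul_pi -ring_piD mulrDr.
Qed.

HB.instance Definition _ := GRing.Zmodule_isPzRing.Build ring_quot
  quot_mulA quot_mul1 quot_mulr1 quot_mulDl quot_mulDr.

End RingQuotient.

Section CentralExtension.
Variables (S : nzRingType) (A : conn_ring S) (R : submod (tA A)).
Variable alpha : tA A -> tA A.

(* In {poly T_A} the variable commutes with the coefficients. *)
Definition central_ext : pzRingType :=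
  ring_quot [set p | exists r, R r /\ p = alpha_z alpha r].

Definition ext_pi : {poly tA A} -> central_ext := @ring_pi _ _.

Definition ext_z : central_ext := ext_pi 'X.

(* D^{<= n}, where t z^i has degree i + k for t of degree k. *)
Definition ext_deg_le (n : int) : set central_ext :=
  [set ext_pi p | p in [set p : {poly tA A} |
    forall i k : nat, n < (i + k)%:Z -> (p`_i : tring _) k = 0]].

Definition ext_ann : set central_ext := [set a | ext_z * a = 0].

Definition ext_regular : Prop := forall a, ext_ann a -> a = 0.

Definition ext_n_regular (c : \bar int) : Prop :=
  match c with
  | n%:E => forall a, ext_ann a -> ext_deg_le n a -> a = 0
  | +oo%E => ext_regular
  | -oo%E => True
  end.

End CentralExtension.

(* For V <> 0, sup {n - 1 | V^n <> 0} is m - 1, where m is the least degree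
   above which V vanishes, or +oo if there is none. *)
Definition complexity (S : nzRingType) (V : grmod S) : \bar int :=
  if pselect (forall v : V, v = 0) then (- 1)%:E
  else if pselect (exists m, `[< forall n, (m < n)%N ->
                     forall v, grmod_deg V n v -> v = 0 >]) is left bnd
       then ((ex_minn bnd)%:Z - 1)%:E else +oo%E.

Section Resolution.
Variables (S : nzRingType) (A : conn_ring S) (V : nat -> grmod S).

(* The terms A, A (x) A^1, A (x) V_2, A (x) V_3, etc: V 0 and V 1 are not
   used. *)
Definition res_obj (n : nat) : lmodType A :=
  match n with
  | 0 => A^o
  | 1 => tens (conn_bimod A) (deg1 A)
  | _ => tens (conn_bimod A) (V n)
  end.

Definition tens_deg (M : lmodType S) (H : nat -> set M) (m : nat) :
    set (tens (conn_bimod A) M) :=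
  span [set t | exists i j a v,
    [/\ (i + j)%N = m, conn_deg A i a, H j v & t = pure (a : conn_bimod A) v]].

Definition res_deg (n m : nat) : set (res_obj n) :=
  match n return set (res_obj n) with
  | 0 => conn_deg A m
  | 1 => tens_deg (fun j (_ : deg1 A) => j = 1%N) m
  | n'.+2 => tens_deg (fun j => grmod_deg (V n'.+2) j) m
  end.

(* d n is the differential d_{n+1}. The augmentation d_0 is the projection onto
   A^0 = S, so that its kernel is given by the vanishing of the component of
   degree 0. *)
Record is_resolution (d : forall n, {linear res_obj n.+1 -> res_obj n}) :
    Prop := IsResolution {
  res_projective : forall n, (2 <= n)%N -> projective (V n);
  res_low : forall n i v, (2 <= n)%N -> (i <= 1)%N ->
    grmod_deg (V n) i v -> v = 0;
  res_graded : forall n m (x : res_obj n.+1), res_deg m x -> res_deg m (d n x);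
  res_d1 : forall (a : A) (x : deg1 A),
    d 0 (pure (a : conn_bimod A) x) = (a * deg1_val x);
  res_exact0 : forall a : A, (exists x, d 0 x = a) <-> conn_comp a 0 = 0;
  res_exact : forall n y, (exists x, d n.+1 x = y) <-> d n y = 0 }.

End Resolution.

(* Main.v *)
Require Import Defs.
From HB Require Import structures.
From mathcomp Require Import all_boot all_algebra.
From mathcomp Require Import boolp classical_sets constructive_ereal.
From mathcomp Require Import freeg.

Set Implicit Arguments.
Unset Strict Implicit.
Unset Printing Implicit Defensive.

Import GRing.Theory Defs.
Local Open Scope ring_scope.

(* Let F_n be the degree n part of the ideal <alpha_z(R)> of T_A[z], evaluated at
   z = 1: then D_n = T^{<= n} / F_n, and z is injective on D_n iff
   F_{n+1} ∩ T^{<= n} = F_n. The symbols of F_n form the degree n part of I = I_A.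
   Let n > c_{V_3}, that is, V_3 is zero in degrees > n, and assume injectivity on
   D_{n-1}. As V_2 is projective, d_2 : V_2 -> A ⊗ A^1 = T^+ / I A^1 lifts to maps
   G_j : V_2^j -> F_j, and F_{n+1} is spanned modulo F_n + F_n A^1 by the t G_j(v)
   of degree n+1. A combination of these in T^{<= n} comes from a syzygy d_3(y) of
   degree n+1; since y is a sum of products w y' with w in A^1 and y' of degree n,
   regularity in degree n-1 shows that the combination is itself in F_n + F_n A^1.
   Finally F_n A^1 ∩ T^{<= n} = F_{n-1} A^1, because A^1 is flat and
   F_n ∩ T^{<= n-1} = F_{n-1}. *)

(** * Spans and dual bases *)

(** The relations in R generate the filtration directly, but V_3 says nothing about the syzygies
    among them: it controls only those among generators indexed by V_2. This forces the change of
    generators from R to the lifts G_j. The two sides of the ideal are treated differently because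
    the resolution consists of left modules: left multiples t G_j(v) are carried by A ⊗ V_2, while
    right multiples F_n A^1 have symbols in I A^1, which vanish in A ⊗ A^1; they are divided out
    together with F_n. The obstacle is that an element of A lifts to T_A only up to I. Sending a ⊗ v
    to t G_j(v) is well defined modulo F_n + F_n A^1 because I_i F_j lies there whenever i + j = n +
    1 ([IA_filt_mul]). Left projectivity of A^1 enters through finite dual bases: contracting the
    last tensor factor recovers the left coefficients, which gives both the injectivity of A ⊗ A^1 =
    T^+ / I A^1 and the flatness argument. *)

Section Span.
Variables (M N : zmodType).

Lemma span_N (X : set M) x : span X x -> span X (- x).
Proof. by move=> Xx; rewrite -[- x]add0r; apply: span_B => //; exact: span_0. Qed.

Lemma span_D (X : set M) x y : span X x -> span X y -> span X (x + y).
Proof. by move=> Xx Xy; rewrite -[y]opprK; apply: span_B => //; exact: span_N. Qed.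

Lemma span_sum (X : set M) (I : Type) (r : seq I) (P : pred I) (F : I -> M) :
  (forall i, P i -> span X (F i)) -> span X (\sum_(i <- r | P i) F i).
Proof.
by move=> XF; apply: (big_ind (span X)) => // *; [exact: span_0|exact: span_D].
Qed.

Lemma span_map (X : set M) (Y : set N) (f : {additive M -> N}) :
  (forall x, X x -> span Y (f x)) -> forall x, span X x -> span Y (f x).
Proof.
move=> Xf x; elim=> [{}x /Xf//||{}x y _ IHx _ IHy]; first by rewrite raddf0;
  exact: span_0.
by rewrite raddfB; exact: span_B.
Qed.

Lemma span_sub (X Y : set M) x : (forall x, X x -> span Y x) -> span X x -> span Y x.
Proof.
by move=> XY; elim=> [z /XY||z y _ ? _ ?] //; [exact: span_0|exact: span_B].
Qed.

Lemma span_pi0 (X : set M) x : span X x <-> span_pi X x = 0.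
Proof. by rewrite -{1}[x]subr0 span_pi_eq raddf0. Qed.

End Span.

Section SpanMul.
Variables (P : nzRingType) (X Y : set P).

Lemma span_mull a x : (forall x, X x -> span Y (a * x)) -> span X x -> span Y (a * x).
Proof.
move=> Xa; elim=> [{}x /Xa//||{}x y _ IHx _ IHy]; first by rewrite mulr0; exact: span_0.
by rewrite mulrBr; exact: span_B.
Qed.

End SpanMul.

Definition linear_pack (S : nzRingType) (U W : lmodType S) (f : U -> W)
    (fL : linear f) : {linear U -> W} :=
  HB.pack f (GRing.isLinear.Build S U W _ f fL).

Section DualBasis.
Variables (S : nzRingType) (P : lmodType S).

(** The evaluation map from the free module on the set P splits, and the coordinates of the section
    are the functionals. One finite family serves all of [ws], because an element of a tensor
    product involves several vectors at once. *)
Lemma projective_dual_basis : projective P -> forall ws : seq P,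
  exists l : seq ({linear P -> S^o} * P),
    forall w, w \in ws -> w = \sum_(x <- l) x.1 w *: x.2.
Proof.
move=> projP.
pose ev : {additive {freeg P / S} -> P} := HB.pack
  (fglift id : {freeg P / S} -> P)
  (GRing.isZmodMorphism.Build _ _ _ (@lift_is_additive S P P id)).
have evU k x : ev << k *g x >> = k *: x by exact: liftU.
have evL : linear ev.
  move=> c D E; rewrite raddfD; congr (_ + _).
  rewrite -[in RHS](freeg_sumE D) [c *: D]/(fgscale c D) /fgscale !raddf_sum.
  by apply: eq_bigr => x _; rewrite !evU -scalerA.
have [|h hK] := projP _ _ (linear_pack evL) (idfun : {linear P -> P}).
  by move=> y; exists << y >>; exact: etrans (evU 1 y) (scale1r y).
have cfL x : linear (fun w => coeff x (h w) : S^o).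
  by move=> c u w; rewrite linearP raddfD /= coeffZ.
(* [s] joins the supports of all the [h w]; points outside the support of a given [h w] contribute
   zero. *)
move=> ws; pose s := undup (flatten [seq dom (h w) | w <- ws]).
exists [seq (linear_pack (cfL x), x) | x <- s] => w ws_w.
rewrite big_map /= -[LHS](hK w) -[LHS]/(ev _) -{1}(freeg_sumE (h w)) raddf_sum.
rewrite [RHS](bigID (mem (dom (h w)))) /= [X in _ + X]big1 ?addr0; last first.
  by move=> x /coeff_outdom ->; rewrite scale0r.
rewrite -[RHS]big_filter. rewrite [LHS](eq_bigr _ (fun x _ => evU _ x)).
apply: perm_big; apply: uniq_perm.
- exact: uniq_dom.
- by rewrite filter_uniq // undup_uniq.
move=> x; rewrite mem_filter mem_undup andb_idr // => xd.
by apply/flattenP; exists (dom (h w)) => //; apply/mapP; exists w.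
Qed.

End DualBasis.

(** * The tensor ring *)

Section TensorRingDegrees.
Variables (S : nzRingType) (V : bimod S S).
Local Notation T := (tring V).
Implicit Types (t u : T) (v w : V).

Lemma thom_is_zmod_morphism n : zmod_morphism (@thom S V n).
Proof.
by move=> t u; apply: tringP => m; rewrite tfunD tfunN /=; case: eqP; rewrite ?subr0.
Qed.
HB.instance Definition _ n :=
  GRing.isZmodMorphism.Build T T (@thom S V n) (thom_is_zmod_morphism n).

Lemma thom0 n : thom n (0 : T) = 0. Proof. exact: raddf0. Qed.

Lemma tfun_sum (I : Type) (r : seq I) (P : pred I) (F : I -> T) n :
  (\sum_(i <- r | P i) F i : T) n = \sum_(i <- r | P i) F i n.
Proof. exact: (big_morph (fun t : T => t n)). Qed.

Lemma thomZ n s t : thom n (s *: t) = s *: thom n t.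
Proof. by apply: tringP => m; rewrite tfunZ /=; case: ifP; rewrite ?scaler0. Qed.

Lemma tdeg_thom n t : tdeg n (thom n t).
Proof. by move=> m /= /negPf ->. Qed.

Lemma thom_id n t : tdeg n t -> thom n t = t.
Proof. by move=> tn; apply: tringP => m /=; case: eqP => // /eqP /tn ->. Qed.

Lemma thom_eq0 m n t : tdeg m t -> n != m -> thom n t = 0.
Proof.
move=> tm nm; apply: tringP => k /=; case: eqP => // ->; exact: tm.
Qed.

Lemma tdeg_leP n t : tdeg_le n t <-> forall m, (n < m)%N -> thom m t = 0.
Proof.
split=> tn m nm; first by apply: tringP => k /=; case: eqP => // ->; rewrite tn.
by have := congr1 (fun u : T => u m) (tn m nm); rewrite /= eqxx.
Qed.

Lemma tdeg_le_sum n t : tdeg_le n t -> t = \sum_(i < n.+1) thom i t.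
Proof.
move=> tn; apply: tringP => m; rewrite tfun_sum /=; have [mn|nm] := ltnP m n.+1.
  rewrite (bigD1 (Ordinal mn)) //= eqxx big1 ?addr0 // => i im.
  by case: eqP => // mi; case/eqP: im; apply: val_inj.
rewrite tn // big1 // => i _; case: eqP => //.
Qed.

Lemma tdeg_le_tsize t : tdeg_le (tsize t) t.
Proof. by move=> m /ltnW /tsizeP. Qed.

Lemma tring_hom_ind (P : T -> Prop) : P 0 ->
  (forall t u, P t -> P u -> P (t + u)) ->
  (forall n t, tdeg n t -> P t) -> forall t, P t.
Proof.
move=> P0 PD Ph t; rewrite (tdeg_le_sum (@tdeg_le_tsize t)).
by apply: (big_ind P) => // i _; exact/(Ph i)/tdeg_thom.
Qed.

Lemma tdeg0 n : tdeg n (0 : T). Proof. by []. Qed.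
Lemma tdegB n t u : tdeg n t -> tdeg n u -> tdeg n (t - u).
Proof. by move=> tn un m mn; rewrite tfunD tfunN tn // un // subr0. Qed.
Lemma tdegZ n s t : tdeg n t -> tdeg n (s *: t).
Proof. by move=> tn m mn; rewrite tfunZ tn // scaler0. Qed.

Lemma tdeg_leB n t u : tdeg_le n t -> tdeg_le n u -> tdeg_le n (t - u).
Proof. by move=> tn un m mn; rewrite tfunD tfunN tn // un // subr0. Qed.
Lemma tdeg_leD n t u : tdeg_le n t -> tdeg_le n u -> tdeg_le n (t + u).
Proof. by move=> tn un m mn; rewrite tfunD tn // un // addr0. Qed.
Lemma tdeg_leW m n t : (m <= n)%N -> tdeg_le m t -> tdeg_le n t.
Proof. by move=> mn tm k nk; apply: tm; exact: leq_ltn_trans nk. Qed.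
Lemma tdeg_le_deg n t : tdeg n t -> tdeg_le n t.
Proof. by move=> tn m nm; apply: tn; rewrite gtn_eqF. Qed.

Definition iota_t v : T := vmul v 1.

Lemma iota_tM v t : iota_t v * t = vmul v t.
Proof. by rewrite -[LHS]/(tmul _ _) /iota_t vmul_tmul tmul1. Qed.

Lemma iota_t_is_zmod_morphism : zmod_morphism iota_t.
Proof.
move=> v w; apply/eqP; rewrite eq_sym subr_eq -vmulDl subrK; exact/eqP.
Qed.
HB.instance Definition _ :=
  GRing.isZmodMorphism.Build V T iota_t iota_t_is_zmod_morphism.

Lemma iota_tZ s v : iota_t (s *: v) = s *: iota_t v.
Proof. exact: vmulZ. Qed.

Lemma iota_t_ract v s : iota_t (ract v s) = iota_t v * s%:A.
Proof. by rewrite iota_tM -vmul_ract. Qed.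

Lemma scalerAM s t u : s *: (t * u) = s *: t * u :> T.
Proof. exact: scalerAl. Qed.

Lemma mul_scalar_t t s u : t * (s *: u) = t * s%:A * u.
Proof. by rewrite -mulrA -scalerAM mul1r. Qed.

Lemma tdeg_vmul v n t : tdeg n t -> tdeg n.+1 (vmul v t).
Proof.
move=> tn [|m] mn //=; rewrite tn //.
by have /(congr1 (fun u : T => u m.+1)) := vmul0 v.
Qed.

Lemma tdeg_tact m (x : tpow V m) n t : tdeg n t -> tdeg (m + n) (tact x t).
Proof.
move=> tn; elim: m x => [|m IH] x; first exact: tdegZ.
elim/tens_ind: x => [|x y IHx IHy|v y]; first by rewrite tact0.
  by rewrite tactBl; exact: tdegB.
by rewrite tact_pure; exact: tdeg_vmul.
Qed.

Lemma tdeg_mulE m t u : tdeg m t -> t * u = tact (t m) u.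
Proof.
move=> tm; rewrite -[LHS]/(tmul _ _) (@tmulE _ _ m.+1).
  by rewrite big_ord_recr /= big1 ?add0r // => i _; rewrite tm ?tact0 // ltn_eqF.
by move=> n /(tdeg_le_deg tm).
Qed.

Lemma tdegM m n t u : tdeg m t -> tdeg n u -> tdeg (m + n) (t * u).
Proof. by move=> tm un; rewrite (tdeg_mulE _ tm); exact: tdeg_tact. Qed.

Lemma tdeg_scalar s : tdeg 0 (s%:A : T).
Proof. by apply: tdegZ => -[]. Qed.

Lemma tone_deg : tdeg 0 (1 : T). Proof. by case. Qed.

Lemma tdeg_iota v : tdeg 1 (iota_t v).
Proof. by apply: tdeg_vmul => -[]. Qed.

Lemma thomMl m n t u : tdeg m t -> thom (m + n) (t * u) = t * thom n u.
Proof.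
move=> tm; elim/tring_hom_ind: u => [|u1 u2 IH1 IH2|k u uk].
- by rewrite !(mulr0, raddf0).
- by rewrite mulrDr !raddfD /= IH1 IH2 mulrDr.
have tuk := tdegM tm uk; have [<-|kn] := eqVneq k n.
  by rewrite !thom_id.
by rewrite (thom_eq0 tuk) ?(thom_eq0 uk) ?mulr0 // ?eqn_add2l eq_sym.
Qed.

Lemma thomMr m n t u : tdeg n u -> thom (m + n) (t * u) = thom m t * u.
Proof.
move=> un; elim/tring_hom_ind: t => [|t1 t2 IH1 IH2|k t tk].
- by rewrite !(mul0r, raddf0).
- by rewrite mulrDl !raddfD /= IH1 IH2 mulrDl.
have tuk := tdegM tk un; have [<-|kn] := eqVneq k m.
  by rewrite !thom_id.
by rewrite (thom_eq0 tuk) ?(thom_eq0 tk) ?mul0r // ?eqn_add2r eq_sym.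
Qed.

Lemma thomMl_lt m k t u : tdeg m t -> (k < m)%N -> thom k (t * u) = 0.
Proof.
move=> tm km; elim/tring_hom_ind: u => [|u1 u2 IH1 IH2|n u un].
- by rewrite mulr0 raddf0.
- by rewrite mulrDr raddfD /= IH1 IH2 addr0.
by rewrite (thom_eq0 (tdegM tm un)) // ltn_eqF // ltn_addr.
Qed.

Lemma thomMr_lt n k t u : tdeg n u -> (k < n)%N -> thom k (t * u) = 0.
Proof.
move=> un kn; elim/tring_hom_ind: t => [|t1 t2 IH1 IH2|m t tm].
- by rewrite mul0r raddf0.
- by rewrite mulrDl raddfD /= IH1 IH2 addr0.
by rewrite (thom_eq0 (tdegM tm un)) // ltn_eqF // ltn_addl.
Qed.

Lemma tdeg_leMl m n t u : tdeg m t -> tdeg_le n u -> tdeg_le (m + n) (t * u).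
Proof.
move=> tm /tdeg_leP un; apply/tdeg_leP => k mnk.
have mk : (m <= k)%N by rewrite (leq_trans _ (ltnW mnk)) // leq_addr.
rewrite -(subnKC mk) thomMl // un ?mulr0 //.
by rewrite ltn_subRL.
Qed.

Lemma tdeg_leMr m n t u : tdeg_le m t -> tdeg n u -> tdeg_le (m + n) (t * u).
Proof.
move=> /tdeg_leP tm un; apply/tdeg_leP => k mnk.
have nk : (n <= k)%N by rewrite (leq_trans _ (ltnW mnk)) // leq_addl.
rewrite -(subnK nk) thomMr // tm ?mul0r //.
by rewrite ltn_subRL addnC.
Qed.

Lemma tdeg0P t : tdeg 0 t -> exists s : S, t = s%:A.
Proof.
move=> t0; exists (t 0%N); apply: tringP => -[|n]; first by rewrite tfunZ /= [RHS]mulr1.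
by rewrite t0 // tfunZ /= scaler0.
Qed.

Lemma tdegSl n t : tdeg n.+1 t ->
  span [set u | exists v y, tdeg n y /\ u = iota_t v * y] t.
Proof.
move=> tn; pose emb (x : tpow V n.+1) : T := tact x 1.
have -> : t = emb (t n.+1) by rewrite /emb -(tdeg_mulE _ tn) mulr1.
elim/tens_ind: (t n.+1) => [|x y IHx IHy|v y]; rewrite /emb.
- by rewrite tact0; exact: span_0.
- by rewrite tactBl; exact: span_B.
rewrite tact_pure -iota_tM; apply: span_gen; exists v, (tact y 1); split=> //.
by have := tdeg_tact y (@tone_deg); rewrite addn0.
Qed.

(** Tensor powers are built by adding factors on the left, so splitting off the last factor takes an
    induction through [tdegSl]. *)
Lemma tdegSr n t : tdeg n.+1 t ->
  span [set u | exists y v, tdeg n y /\ u = y * iota_t v] t.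
Proof.
elim: n t => [|n IH] t /tdegSl.
  apply: span_sub => _ [v [y [/tdeg0P[s ->] ->]]]; apply: span_gen.
  exists 1, (ract v s); split; first exact: tone_deg.
  by rewrite mul1r iota_t_ract.
apply: span_sub => _ [v [y [/IH yn ->]]].
apply: (span_mull _ yn) => _ [y' [w [y'n ->]]].
apply: span_gen; exists (iota_t v * y'), w; rewrite mulrA; split=> //.
exact: (tdegM (tdeg_iota v) y'n).
Qed.

Lemma tdeg1P t : tdeg 1 t -> exists v, t = iota_t v.
Proof.
move/tdegSl; elim=> [_ [v [y [/tdeg0P[s ->] ->]]]||_ _ _ [v ->] _ [w ->]].
- by exists (ract v s); rewrite iota_t_ract.
- by exists 0; rewrite raddf0.
- by exists (v - w); rewrite raddfB.
Qed.

End TensorRingDegrees.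

(* The right contraction t ⊗ v |-> t phi(v) on T^+ = T ⊗ V. *)
Section Contraction.
Variables (S : nzRingType) (V : bimod S S) (phi : {linear V -> S^o}).
Local Notation T := (tring V).

Fixpoint rcontract_pow (n : nat) : tpow V n.+1 -> tpow V n :=
  match n return tpow V n.+1 -> tpow V n with
  | 0 => tlift (fun v (s : S^o) => phi (ract v s))
  | n'.+1 => tlift (fun v y => pure v (@rcontract_pow n' y))
  end.

(** The three claims need one common induction: [tlift] computes only on balanced maps, and the map
    defining level n + 1 is balanced because level n is linear. *)
Lemma rcontract_pow_spec n :
  [/\ forall x y, @rcontract_pow n (x - y) = rcontract_pow x - rcontract_pow y,
      forall s x, @rcontract_pow n (s *: x) = s *: rcontract_pow x
    & balanced (fun (v : V) (y : tpow V n.+1) => pure v (rcontract_pow y))].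
Proof.
elim: n => [|n [IHB IHZ IHb]].
  have b0 : balanced (fun v (s : S^o) => phi (ract v s)).
    split=> [b c m|b m n|b s m]; rewrite ?ractDl ?ractDr ?raddfD //.
    by rewrite -ractA.
  have B (x y : tpow V 1) : rcontract_pow (x - y) = rcontract_pow x - rcontract_pow y.
    exact: tliftB.
  have D (x y : tpow V 1) : rcontract_pow (x + y) = rcontract_pow x + rcontract_pow y.
    exact: tliftD.
  have Z s (x : tpow V 1) : rcontract_pow (s *: x) = s *: rcontract_pow x.
    elim/tens_ind: x => [|x y IHx IHy|v y]; first by rewrite scaler0 /= tlift0 ?scaler0.
      by rewrite scalerBr !B scalerBr IHx IHy.
    by rewrite tens_scale_pure /= !tlift_pure // ractZ linearZ.
  split=> //; split=> [b c m|b m n|b s m]; first exact: pureDl.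
    by rewrite D pureDr.
  by rewrite Z -pure_ract.
have B (x y : tpow V n.+2) : rcontract_pow (x - y) = rcontract_pow x - rcontract_pow y.
  exact: tliftB.
have c0 : rcontract_pow (0 : tpow V n.+2) = 0 by rewrite -(subrr 0) B subrr.
have Z s (x : tpow V n.+2) : rcontract_pow (s *: x) = s *: rcontract_pow x.
  elim/tens_ind: x => [|x y IHx IHy|v y]; first by rewrite scaler0 c0 scaler0.
    by rewrite scalerBr !B scalerBr IHx IHy.
  by rewrite tens_scale_pure /= !tlift_pure // tens_scale_pure.
have D (x y : tpow V n.+2) : rcontract_pow (x + y) = rcontract_pow x + rcontract_pow y.
  exact: tliftD.
split=> //; split=> *; first exact: pureDl.
  by rewrite D pureDr.
by rewrite Z -pure_ract.
Qed.

Lemma rcontract_powB n (x y : tpow V n.+1) :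
  rcontract_pow (x - y) = rcontract_pow x - rcontract_pow y.
Proof. by case: (rcontract_pow_spec n). Qed.

Lemma rcontract_pow0 n : rcontract_pow (0 : tpow V n.+1) = 0.
Proof. by rewrite -(subrr 0) rcontract_powB subrr. Qed.

Program Definition rcontract (t : T) : T :=
  @Tring _ _ (fun n => rcontract_pow (t n.+1)) _.
Next Obligation.
have [N tN] := tfun_fin t; exists N => n Nn.
by rewrite tN ?rcontract_pow0 // (leq_trans Nn).
Qed.

Lemma rcontract_is_zmod_morphism : zmod_morphism rcontract.
Proof. by move=> t u; apply: tringP => n /=; rewrite rcontract_powB. Qed.
HB.instance Definition _ :=
  GRing.isZmodMorphism.Build T T rcontract rcontract_is_zmod_morphism.

Lemma tdeg_le_rcontract n t : tdeg_le n.+1 t -> tdeg_le n (rcontract t).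
Proof. by move=> tn m nm /=; rewrite tn ?rcontract_pow0. Qed.

(** A component of t in degree 0 would leave [v] as the last tensor factor, and [phi] would act on
    it. *)
Lemma rcontract_iotaM v (t : T) : t 0%N = 0 ->
  rcontract (iota_t v * t) = iota_t v * rcontract t.
Proof.
move=> t0; apply: tringP => -[|n]; rewrite !iota_tM /=; last first.
  by rewrite tlift_pure //; case: (rcontract_pow_spec n).
rewrite t0 -[X in tlift _ X]/(pure v (0 : tpow V 0)).
have := pureDr v (0 : tpow V 0) 0; rewrite addr0 => /esym/(canRL (addrK _)).
by rewrite subrr => ->; exact: (rcontract_pow0 0).
Qed.

Lemma rcontract_iota v : rcontract (iota_t v) = (phi v : S)%:A :> T.
Proof.
apply: tringP => -[|n]; rewrite tfunZ; last first.
  rewrite -[LHS]/(rcontract_pow (iota_t v n.+2)) (tdeg_iota v) //.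
  by rewrite rcontract_pow0 scaler0.
rewrite /= tlift_pure ?ract1 ?[RHS]mulr1 //.
split=> [b c m|b m n|b s m]; rewrite ?ractDl ?ractDr ?raddfD //.
by rewrite -ractA.
Qed.

Lemma rcontractM t v : rcontract (t * iota_t v) = t * (phi v : S)%:A :> T.
Proof.
elim/tring_hom_ind: t => [|t u IHt IHu|n t].
- by rewrite !mul0r raddf0.
- by rewrite !mulrDl raddfD /= IHt IHu.
elim: n t => [|n IH] t.
  move=> /tdeg0P[s ->].
  by rewrite -!scalerAM !mul1r -iota_tZ rcontract_iota linearZ scalerA.
move/tdegSl; elim=> [_ [w [y [yn ->]]]||t1 t2 _ IH1 _ IH2].
- rewrite -!mulrA rcontract_iotaM ?IH //.
  by apply: (tdegM yn (tdeg_iota v)); rewrite addn1.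
- by rewrite !mul0r raddf0.
- by rewrite !mulrBl raddfB /= IH1 IH2.
Qed.

End Contraction.

(** * Gradings and the projection onto A *)

Section Grading.
Variables (S : nzRingType) (M : lmodType S) (G : nat -> submod M).
Hypothesis gradG : is_grading G.

Lemma submodD (U : submod M) x y : U x -> U y -> U (x + y).
Proof. by move=> Ux Uy; rewrite -[x]scale1r; exact: submod_lin. Qed.
Lemma submodZ (U : submod M) a x : U x -> U (a *: x).
Proof.
by move=> Ux; rewrite -[_ *: _]addr0; apply: submod_lin => //; exact: submod_0.
Qed.
Lemma submodB (U : submod M) x y : U x -> U y -> U (x - y).
Proof. by move=> Ux Uy; rewrite -scaleN1r; apply/submodD/submodZ. Qed.

Definition gcomp (x : M) : nat -> M := projT1 (cid (gradG x)).

Lemma gcompP x : decomposes G x (gcomp x).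
Proof. by rewrite /gcomp; case: cid => f []. Qed.

Lemma gcomp_uniq x f : decomposes G x f -> gcomp x = f.
Proof. by move=> xf; rewrite /gcomp; case: cid => g [/= _ gu]; exact: gu. Qed.

Lemma gcomp_deg x n : G n (gcomp x n).
Proof. by case: (gcompP x). Qed.

Lemma gcomp_sum x : exists N, x = \sum_(n < N) gcomp x n.
Proof. by case: (gcompP x) => _ [N [_ xE]]; exists N. Qed.

Lemma sum_finsupp (f : nat -> M) N K : (forall n, (N <= n)%N -> f n = 0) ->
  (N <= K)%N -> \sum_(n < K) f n = \sum_(n < N) f n.
Proof.
move=> fN NK; rewrite [RHS](big_ord_widen K f NK) [LHS](bigID (fun i : 'I_K => (i <
  N)%N)) /=.
by rewrite [X in _ + X]big1 ?addr0 // => i; rewrite -leqNgt => /fN.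
Qed.

Lemma gcomp_linear n : linear (gcomp^~ n).
Proof.
move=> a x y; have [xG [N [xN xE]]] := gcompP x; have [yG [K [yK yE]]] := gcompP y.
rewrite (@gcomp_uniq _ (fun n => a *: gcomp x n + gcomp y n)) //; split.
  by move=> m; exact: submod_lin.
exists (maxn N K); split=> [m|].
  by rewrite geq_max => /andP[Nm Km]; rewrite xN // yK // scaler0 addr0.
rewrite big_split -scaler_sumr /= (sum_finsupp xN) ?leq_maxl //.
by rewrite (sum_finsupp yK) ?leq_maxr // -xE -yE.
Qed.

Lemma gcomp_hom m x : G m x -> gcomp x = fun n => if n == m then x else 0.
Proof.
move=> xm; apply: gcomp_uniq; split=> [n|].
  by case: eqP => [->|_] //; exact: submod_0.
exists m.+1; split=> [n mn|]; first by rewrite gtn_eqF.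
by rewrite big_ord_recr /= eqxx big1 ?add0r // => i _; rewrite ltn_eqF.
Qed.

Lemma gcomp_id m x : G m x -> gcomp x m = x.
Proof. by move/gcomp_hom ->; rewrite eqxx. Qed.

Lemma graded_ind (P : M -> Prop) : P 0 -> (forall x y, P x -> P y -> P (x + y)) ->
  (forall n x, G n x -> P x) -> forall x, P x.
Proof.
move=> P0 PD PG x; have [N ->] := gcomp_sum x.
by apply: (big_ind P) => // i _; exact/(PG i)/gcomp_deg.
Qed.

Lemma graded_sum0 N (f : nat -> M) : (forall n, G n (f n)) ->
  \sum_(n < N) f n = 0 -> forall n, (n < N)%N -> f n = 0.
Proof.
move=> fG sum0 n nN; have : gcomp 0 = fun n => if (n < N)%N then f n else 0.
  apply: gcomp_uniq; split=> [m|]; first by case: ifP => // _; exact: submod_0.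
  exists N; split=> [m|]; first by rewrite ltnNge => ->.
  by rewrite -[LHS]sum0; apply: eq_bigr => i _; rewrite ltn_ord.
rewrite (@gcomp_hom 0 0); last exact: submod_0.
by move/(congr1 (@^~ n)); rewrite if_same nN.
Qed.

End Grading.

Section TensorRingProjection.
Variables (S : nzRingType) (A : conn_ring S).
Local Notation V := (deg1 A).
Local Notation T := (tring V).

Lemma deg1_valD (v w : V) : deg1_val (v + w) = deg1_val v + deg1_val w.
Proof. by []. Qed.
Lemma deg1_valZ s (v : V) : deg1_val (s *: v) = s *: deg1_val v.
Proof. by []. Qed.
Lemma deg1_val_ract (v : V) s : deg1_val (ract v s) = deg1_val v * s%:A.
Proof. by []. Qed.
Lemma deg1_valP (v : V) : conn_deg A 1 (deg1_val v).
Proof. by apply/asboolP; exact: sub_valP. Qed.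
Lemma deg1_val_inj : injective (@deg1_val S A).
Proof. by move=> v w vw; exact: val_inj. Qed.
Lemma deg1_ex a : conn_deg A 1 a -> exists v : V, deg1_val v = a.
Proof. by move=> /asboolP a1; exists (SubOf a1). Qed.

Lemma pi_pow_spec n :
  [/\ forall x y, @pi_pow S A n (x + y) = pi_pow x + pi_pow y,
      forall s x, @pi_pow S A n (s *: x) = s *: pi_pow x
    & balanced (fun (v : V) (y : tpow V n) => deg1_val v * pi_pow y)].
Proof.
have b n' : (forall x y, @pi_pow S A n' (x + y) = pi_pow x + pi_pow y) ->
    (forall s x, @pi_pow S A n' (s *: x) = s *: pi_pow x) ->
    balanced (fun (v : V) (y : tpow V n') => deg1_val v * pi_pow y).
  move=> D Z; split=> *; first by rewrite deg1_valD mulrDl.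
    by rewrite D mulrDr.
  by rewrite deg1_val_ract Z -mulrA mulr_algl.
elim: n => [|n [IHD IHZ IHb]].
  have D x y : @pi_pow S A 0 (x + y) = pi_pow x + pi_pow y by exact: scalerDl.
  have Z s x : @pi_pow S A 0 (s *: x) = s *: pi_pow x by rewrite /= scalerA.
  by split=> //; exact: b.
have D x y : @pi_pow S A n.+1 (x + y) = pi_pow x + pi_pow y by exact: tliftD.
have B x y : @pi_pow S A n.+1 (x - y) = pi_pow x - pi_pow y by exact: tliftB.
have c0 : @pi_pow S A n.+1 0 = 0 by exact: tlift0.
have Z s x : @pi_pow S A n.+1 (s *: x) = s *: pi_pow x.
  elim/tens_ind: x => [|x y IHx IHy|v y]; first by rewrite scaler0 c0 scaler0.
    by rewrite scalerBr !B scalerBr IHx IHy.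
  by rewrite tens_scale_pure /= !tlift_pure // deg1_valZ scalerAl.
by split=> //; exact: b.
Qed.

Lemma pi_powD n x y : @pi_pow S A n (x + y) = pi_pow x + pi_pow y.
Proof. by case: (pi_pow_spec n). Qed.
Lemma pi_powZ n s x : @pi_pow S A n (s *: x) = s *: pi_pow x.
Proof. by case: (pi_pow_spec n). Qed.
Lemma pi_pow0 n : @pi_pow S A n 0 = 0.
Proof. by rewrite -(scale0r 0) pi_powZ scale0r. Qed.

Lemma piAE N (t : T) : (forall n, (N <= n)%N -> t n = 0) ->
  piA t = \sum_(n < N) pi_pow (t n).
Proof.
move=> tN; have pN n : (N <= n)%N -> pi_pow (t n) = 0 by move=> /tN ->; rewrite pi_pow0.
have ps n : (tsize t <= n)%N -> pi_pow (t n) = 0 by move=> /tsizeP ->; rewrite pi_pow0.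
rewrite /piA; have [le|/ltnW le] := leqP (tsize t) N.
  exact/esym/(sum_finsupp ps).
exact: (sum_finsupp pN).
Qed.

Lemma piA_hom n (t : T) : tdeg n t -> piA t = pi_pow (t n).
Proof.
move=> tn; rewrite (@piAE n.+1) => [|m nm]; last by rewrite tn // gtn_eqF.
by rewrite big_ord_recr /= big1 ?add0r // => i _; rewrite tn ?pi_pow0 // ltn_eqF.
Qed.

Lemma piA_linear : linear (@piA S A).
Proof.
move=> s t u; pose N := maxn (tsize t) (tsize u).
have tN n : (N <= n)%N -> t n = 0 by rewrite geq_max => /andP[/tsizeP].
have uN n : (N <= n)%N -> u n = 0 by rewrite geq_max => /andP[_ /tsizeP].
rewrite (piAE tN) (piAE uN) (@piAE N) => [|n Nn].
  by rewrite scaler_sumr -big_split; apply: eq_bigr => i _; rewrite pi_powD pi_powZ.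
by rewrite tfunD tfunZ tN ?uN ?scaler0 ?addr0.
Qed.
HB.instance Definition _ :=
  GRing.isLinear.Build S T A _ (@piA S A) piA_linear.

Lemma piA_vmul v (t : T) : piA (vmul v t) = deg1_val v * piA t.
Proof.
elim/tring_hom_ind: t => [|t u IHt IHu|n t tn].
- by rewrite vmul0 raddf0 mulr0.
- by rewrite vmulDr !raddfD /= IHt IHu mulrDr.
rewrite (piA_hom (tdeg_vmul v tn)) (piA_hom tn) /= tlift_pure //.
by case: (pi_pow_spec n).
Qed.

Lemma piA_scalar s : piA (s%:A : T) = s%:A.
Proof. by rewrite (piA_hom (tdeg_scalar _ _)) tfunZ pi_powZ /= scale1r. Qed.

Lemma piA1 : piA (1 : T) = 1.
Proof. by rewrite -[X in piA X](scale1r) piA_scalar scale1r. Qed.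

Lemma piA_iota (v : V) : piA (iota_t v) = deg1_val v.
Proof. by rewrite piA_vmul piA1 mulr1. Qed.

Lemma piAM (t u : T) : piA (t * u) = piA t * piA u.
Proof.
elim/tring_hom_ind: t => [|t t' IH IH'|n t tn].
- by rewrite mul0r raddf0 mul0r.
- by rewrite mulrDl !raddfD /= IH IH' mulrDl.
elim: n t tn => [|n IH] t.
  by move=> /tdeg0P[s ->]; rewrite -scalerAM mul1r linearZ piA_scalar mulr_algl.
move=> /tdegSl; elim=> [_ [v [y [yn ->]]]||x y _ IHx _ IHy].
- by rewrite -mulrA !iota_tM !piA_vmul IH // mulrA.
- by rewrite mul0r raddf0 mul0r.
- by rewrite mulrBl !raddfB /= IHx IHy mulrBl.
Qed.

Lemma piA_deg n (t : T) : tdeg n t -> conn_deg A n (piA t).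
Proof.
elim: n t => [|n IH] t.
  by move=> /tdeg0P[s ->]; apply/conn_deg0; exists s; exact: piA_scalar.
move=> /tdegSl; elim=> [_ [v [y [yn ->]]]||x y _ IHx _ IHy].
- by rewrite piAM piA_iota; apply: (conn_degM (deg1_valP v)); exact: IH.
- by rewrite raddf0; exact: submod_0.
- by rewrite raddfB; exact: submodB.
Qed.

(** The elements [piA (thom i t)] are homogeneous of distinct degrees with sum [piA t], so they
    vanish together with it. *)
Lemma IA_thom n (t : T) : IA t -> IA (thom n t).
Proof.
move=> t0; have [nt|] := ltnP n (tsize t).+1; last first.
  by move=> /tdeg_le_tsize tn; apply: etrans (raddf0 _); congr piA;
    apply: tringP => m /=; case: eqP => // ->.
apply: (graded_sum0 (conn_grading (c := A)) (N := (tsize t).+1)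
          (f := fun i => piA (thom i t))) nt.
  by move=> m; exact/piA_deg/tdeg_thom.
by rewrite -raddf_sum -(tdeg_le_sum (@tdeg_le_tsize _ _ t)).
Qed.

Lemma IA0 : IA (0 : T). Proof. exact: raddf0. Qed.
Lemma IAB (t u : T) : IA t -> IA u -> IA (t - u).
Proof. by rewrite /IA /= raddfB /= => -> ->; rewrite subr0. Qed.
Lemma IAMl (t u : T) : IA u -> IA (t * u).
Proof. by rewrite /IA /= piAM => ->; rewrite mulr0. Qed.
Lemma IAMr (t u : T) : IA t -> IA (t * u).
Proof. by rewrite /IA /= piAM => ->; rewrite mul0r. Qed.

Lemma IA_deg1 (t : T) : tdeg 1 t -> IA t -> t = 0.
Proof.
move=> /tdeg1P[v ->]; rewrite /IA /= piA_iota => v0.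
by rewrite (_ : v = 0) ?raddf0 //; exact: deg1_val_inj.
Qed.

Lemma IA_deg0 (t : T) : tdeg 0 t -> IA t -> t = 0.
Proof.
move=> /tdeg0P[s ->]; rewrite /IA /= piA_scalar => s0.
by rewrite (_ : s = 0) ?scale0r //; apply: (@conn_inj _ A); rewrite s0 scale0r.
Qed.

Hypothesis strA : strongly_graded A.

Lemma conn_degS n a : conn_deg A n.+1 a ->
  span [set z : A | exists v y, conn_deg A n y /\ z = deg1_val v * y] a.
Proof.
rewrite -[n.+1]add1n -[_ a]/((submod_set (conn_deg A (1 + n)) : set A) a) strA.
apply: span_sub => _ [x [y [/deg1_ex[v <-] yn ->]]].
by apply: span_gen; exists v, y.
Qed.

Lemma piA_surj_deg n a : conn_deg A n a -> exists t : T, tdeg n t /\ piA t = a.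
Proof.
elim: n a => [|n IH] a.
  by move=> /conn_deg0[s ->]; exists (s%:A); split;
    [exact: tdeg_scalar|exact: piA_scalar].
move=> /conn_degS; elim=> [_ [v [y [/IH[t [tn <-]] ->]]]
  ||_ _ _ [t [tn <-]] _ [u [un <-]]].
- exists (iota_t v * t); rewrite piAM piA_iota; split=> //.
  exact: (tdegM (tdeg_iota v) tn).
- by exists 0; rewrite raddf0.
- by exists (t - u); rewrite raddfB; split=> //; exact: tdegB.
Qed.

Lemma piA_surj a : exists t : T, piA t = a.
Proof.
elim/(graded_ind (conn_grading (c := A))): a => [|_ _ [t <-] [u <-]|n a].
- by exists 0; exact: raddf0.
- by exists (t + u); exact: raddfD.
by move=> /piA_surj_deg[t [_ <-]]; exists t.
Qed.

End TensorRingProjection.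

(** * The filtration F_n and the central extension *)

Section Filtration.
Local Open Scope classical_set_scope.
Variables (S : nzRingType) (A : conn_ring S) (R : submod (tA A)).
Variable alpha : tA A -> tA A.
Hypothesis relR : relation_bimodule R.
Hypothesis filR : filtered_morphism R alpha.
Local Notation V := (deg1 A).
Local Notation T := (tring V).

Lemma rel0 : R (0 : T). Proof. exact: submod_0. Qed.
Lemma relM (r : T) s : R r -> R (r * s%:A : T).
Proof. by case: relR => RM _ _ _; exact: RM. Qed.
Lemma rel_thom n (r : T) : R r -> R (thom n r).
Proof. by case: relR => _ Rt _ _; exact: Rt. Qed.
Lemma rel_IA (r : T) : R r -> IA r.
Proof.
case: relR => _ _ RI _ Rr; apply/RI; exists r, 0; split=> //; first exact: span_0.
by rewrite addr0.
Qed.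

Lemma rel_deg01 n (r : T) : (n <= 1)%N -> R r -> tdeg n r -> r = 0.
Proof.
by case: n => [|[|n]] // _ /rel_IA; [move/[swap]/IA_deg0|move/[swap]/IA_deg1]; exact.
Qed.

Lemma alphaP s (r r' : T) : R r -> R r' ->
  alpha (s *: r + r') = s *: alpha r + alpha r' :> T.
Proof. by case: filR => aP _ _; exact: aP. Qed.

Lemma alpha0 : alpha (0 : T) = 0 :> T.
Proof.
have := alphaP 1 rel0 rel0; rewrite !scale1r addr0.
by move=> /esym/(canRL (addrK _)); rewrite subrr.
Qed.

(* alpha_z(r) at z = 1 for r in R^n: the degree n part of alpha r is discarded
   because alpha_0 is the inclusion by convention. *)
Definition deform n (r : T) : T := r + (alpha r - thom n (alpha r)).

Lemma deformP n s (r r' : T) : R r -> R r' ->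
  deform n (s *: r + r') = s *: deform n r + deform n r'.
Proof.
move=> Rr Rr'; rewrite /deform alphaP // raddfD /= thomZ.
by rewrite opprD [X in _ + X]addrACA -scalerBr addrACA -scalerDr.
Qed.

Lemma deform0 n : deform n 0 = 0.
Proof. by rewrite /deform alpha0 raddf0 subrr addr0. Qed.

Lemma deformM n s (r : T) : R r -> deform n (r * s%:A) = deform n r * s%:A.
Proof.
move=> Rr; have aM : alpha (r * s%:A) = alpha r * s%:A :> T by case: filR => _ aM _;
  exact: aM.
rewrite /deform aM -{1}[n]addn0 (thomMr _ _ (tdeg_scalar _ _)).
by rewrite mulrDl mulrBl.
Qed.

(* F_n is the degree n part of the ideal generated by alpha_z(R), with z
   specialised to 1; the degree n part of the central extension is thus
   T^{<= n} / F_n. *)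
Inductive filt : nat -> T -> Prop :=
| filt_rel n r : R r -> tdeg n r -> filt n (deform n r)
| filt_S n x : filt n x -> filt n.+1 x
| filt_vM n v x : filt n x -> filt n.+1 (iota_t v * x)
| filt_Mv n v x : filt n x -> filt n.+1 (x * iota_t v)
| filtB n x y : filt n x -> filt n y -> filt n (x - y).

Lemma filt0 n : filt n 0.
Proof. by rewrite -(deform0 n); apply: filt_rel; [exact: rel0|exact: tdeg0]. Qed.
Lemma filtN n x : filt n x -> filt n (- x).
Proof. by move=> xn; rewrite -sub0r; apply: filtB => //; exact: filt0. Qed.
Lemma filtD n x y : filt n x -> filt n y -> filt n (x + y).
Proof. by move=> xn yn; rewrite -[y]opprK; apply: filtB => //; exact: filtN. Qed.

Lemma filt_sum n (I : Type) (r : seq I) (P : pred I) (F : I -> T) :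
  (forall i, P i -> filt n (F i)) -> filt n (\sum_(i <- r | P i) F i).
Proof.
by move=> FF; apply: (big_ind (filt n)) => // *; [exact: filt0|exact: filtD].
Qed.

Lemma filt_span n (X : set T) x : (forall y, X y -> filt n y) -> span X x -> filt n x.
Proof. by move=> Xn; elim=> [y /Xn||y z _ ? _ ?] //; [exact: filt0|exact: filtB]. Qed.

Lemma filtW m n x : (m <= n)%N -> filt m x -> filt n x.
Proof.
by move/subnKC <-; elim: (n - m)%N => [|k IH] xm; rewrite ?addn0 // addnS;
  apply/filt_S/IH.
Qed.

Lemma filtZ n s x : filt n x -> filt n (s *: x).
Proof.
elim=> [{}n r Rr rn|{}n {}x _ IH|{}n v {}x xn _|{}n v {}x _ IH|{}n {}x y _ IHx _ IHy].
- have := deformP n s Rr rel0; rewrite deform0 !addr0 => <-.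
  by apply: filt_rel; [exact: submodZ|exact: tdegZ].
- exact: filt_S.
- by rewrite scalerAM -iota_tZ; exact: filt_vM.
- by rewrite scalerAM; exact: filt_Mv.
- by rewrite scalerBr; exact: filtB.
Qed.

Lemma filt_scalar n s x : filt n x -> filt n (x * s%:A).
Proof.
elim=> [{}n r Rr rn|{}n {}x _ IH|{}n v {}x xn IH|{}n v {}x xn _|{}n {}x y _ IHx _ IHy].
- rewrite -deformM //; apply: filt_rel; first exact: relM.
  by rewrite -[n]addn0; apply: tdegM => //; exact: tdeg_scalar.
- exact: filt_S.
- by rewrite -mulrA; exact: filt_vM.
- by rewrite -mulrA -iota_t_ract; exact: filt_Mv.
- by rewrite mulrBl; exact: filtB.
Qed.

Lemma filtMl m n (t : T) x : tdeg m t -> filt n x -> filt (m + n) (t * x).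
Proof.
elim: m t x => [|m IH] t x.
  by move=> /tdeg0P[s ->] xn; rewrite -scalerAM mul1r; exact: filtZ.
move=> /tdegSl tm xn; elim: tm => [_ [v [y [ym ->]]]||y z _ IHy _ IHz].
- by rewrite -mulrA; apply/filt_vM/IH.
- by rewrite mul0r; exact: filt0.
- by rewrite mulrBl; exact: filtB.
Qed.

Lemma filtMr m n (t : T) x : tdeg n t -> filt m x -> filt (m + n) (x * t).
Proof.
elim: n t x => [|n IH] t x.
  by move=> /tdeg0P[s ->] xn; rewrite addn0; exact: filt_scalar.
move=> /tdegSr tm xn; elim: tm => [_ [y [v [ym ->]]]||y z _ IHy _ IHz].
- by rewrite mulrA addnS; apply/filt_Mv/IH.
- by rewrite mulr0; exact: filt0.
- by rewrite mulrBr; exact: filtB.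
Qed.

Lemma deform_le n (r : T) : R r -> tdeg n r -> tdeg_le n (deform n r).
Proof.
move=> Rr rn; apply: tdeg_leD; first exact: tdeg_le_deg.
apply: tdeg_leB; last exact/tdeg_le_deg/tdeg_thom.
by case: filR => _ _; exact.
Qed.

Lemma thom_deform n (r : T) : tdeg n r -> thom n (deform n r) = r.
Proof.
move=> rn; rewrite raddfD raddfB /= (thom_id rn) (thom_id (@tdeg_thom _ _ n _)).
by rewrite subrr addr0.
Qed.

Lemma filt_le n x : filt n x -> tdeg_le n x.
Proof.
elim=> [{}n r Rr rn|{}n {}x _ IH|{}n v {}x xn IH|{}n v {}x xn IH|{}n {}x y _ IHx _ IHy].
- exact: deform_le.
- exact: tdeg_leW IH.
- exact: (tdeg_leMl (tdeg_iota v) IH).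
- by rewrite -addn1; exact: (tdeg_leMr IH (tdeg_iota v)).
- exact: tdeg_leB.
Qed.

Lemma filt_symbol n x : filt n x -> IA (thom n x).
Proof.
elim=> [{}n r Rr rn|{}n {}x xn _|{}n v {}x xn IH|{}n v {}x xn IH|{}n {}x y _ IHx _ IHy].
- by rewrite thom_deform //; exact: rel_IA.
- by rewrite (iffLR (tdeg_leP _ _) (filt_le xn)) //; exact: IA0.
- by rewrite -add1n (thomMl _ _ (tdeg_iota v)); exact: IAMl.
- by rewrite -addn1 (thomMr _ _ (tdeg_iota v)); exact: IAMr.
- by rewrite raddfB; exact: IAB.
Qed.

(** Together with [filt_symbol] this identifies the symbols of F_n with I_n. By induction along I =
    R + (A^1 I + I A^1): relations lift by [deform], products by products of lifts. *)
Lemma IA_lift n (u : T) : IA u -> tdeg n u -> exists x, filt n x /\ thom n x = u.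
Proof.
case: relR => _ _ RI _; elim: n u => [|n IH] u uI un.
  by exists 0; split; [exact: filt0|rewrite (IA_deg0 un uI) raddf0].
have [r [w [Rr wI uE]]] := iffLR (RI u) uI.
suff [y [yn yw]] : exists y, filt n.+1 y /\ thom n.+1 y = thom n.+1 w.
  exists (deform n.+1 (thom n.+1 r) + y); split.
    apply: filtD => //; apply: filt_rel; first exact: rel_thom.
    exact: tdeg_thom.
  by rewrite raddfD /= thom_deform ?yw;
    [rewrite -raddfD -uE /= thom_id|exact: tdeg_thom].
elim: wI {uE} => [{}w [x [v [/tdeg1P[a ->] vI]]]
  ||w1 w2 _ [y1 [y1n y1w]] _ [y2 [y2n y2w]]].
- have [y [yn yv]] := IH _ (IA_thom n vI) (@tdeg_thom _ _ n v).
  case=> ->; [exists (iota_t a * y)|exists (y * iota_t a)]; split.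
  + exact: filt_vM.
  + by rewrite -add1n !(thomMl _ _ (tdeg_iota a)) yv.
  + exact: filt_Mv.
  + by rewrite -addn1 !(thomMr _ _ (tdeg_iota a)) yv.
- by exists 0; split=> //; exact: filt0.
- by exists (y1 - y2); rewrite !raddfB /= y1w y2w; split=> //; exact: filtB.
Qed.

Definition filt_gens n : set T :=
  [set y | [\/ filt n y, exists v f, filt n f /\ y = iota_t v * f
             | exists v f, filt n f /\ y = f * iota_t v]].

(** Since [deform] is additive on R, a single relation of degree n absorbs all uses of [filt_rel];
    the rest comes from one degree below. In degree 0 nothing is left, as R has no element there. *)
Lemma filt_decompose n x : filt n x ->
  if n is m.+1 then
    exists r y, [/\ R r, tdeg n r, span (filt_gens m) y & x = deform n r + y]
  else x = 0.
Proof.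
elim=> [{}n r Rr rn|{}n {}x xn _|{}n v {}x xn _|{}n v {}x xn _|{}n {}x y _ IHx _ IHy].
- case: n rn => [|n] rn; first by rewrite (rel_deg01 _ Rr rn) ?deform0.
  by exists r, 0; rewrite addr0; split=> //; exact: span_0.
- exists 0, x; rewrite deform0 add0r; split=> //; [exact: rel0|].
  by apply: span_gen; constructor 1.
- exists 0, (iota_t v * x); rewrite deform0 add0r; split=> //; [exact: rel0|].
  by apply: span_gen; constructor 2; exists v, x.
- exists 0, (x * iota_t v); rewrite deform0 add0r; split=> //; [exact: rel0|].
  by apply: span_gen; constructor 3; exists v, x.
case: n IHx IHy => [-> ->|n]; first by rewrite subrr.
move=> [r [a [Rr rn an ->]]] [r' [b [Rr' r'n bn ->]]].
exists (r - r'), (a - b); split; [exact: submodB|exact: tdegB|exact: span_B|].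
have := deformP n.+1 (-1) Rr' Rr; rewrite !scaleN1r => dE.
by rewrite [r - r']addrC dE opprD addrACA [- _ + _]addrC.
Qed.

Lemma filt_0 x : filt 0 x -> x = 0. Proof. exact: filt_decompose. Qed.

End Filtration.

(** * Homogenisation: passing between T[z] and T *)

Section Homogenization.
Variables (S : nzRingType) (V : bimod S S).
Local Notation T := (tring V).

Definition homog n (x : T) : {poly T} := \poly_(i < n.+1) thom (n - i) x.

(* The degree n part of q, with z specialised to 1. *)
Program Definition dehomog n (q : {poly T}) : T :=
  @Tring _ _ (fun m => if (m <= n)%N then (q`_(n - m) : T) m else 0) _.
Next Obligation. by exists n.+1 => m; rewrite ltnNge => /negPf ->. Qed.

Lemma thom_inj (t u : T) : (forall m, thom m t = thom m u) -> t = u.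
Proof.
by move=> tu; apply: tringP => m; have := congr1 (fun x : T => x m) (tu m);
  rewrite /= eqxx.
Qed.

Lemma thom_dehomog m n q :
  thom m (dehomog n q) = if (m <= n)%N then thom m q`_(n - m) else 0.
Proof.
apply: tringP => k /=; case: eqP => [->|km]; first by case: ifP => //=; rewrite eqxx.
by case: ifP => //= _; move/eqP/negPf: km => ->.
Qed.

Lemma dehomog_is_zmod_morphism n : zmod_morphism (dehomog n).
Proof.
by move=> p q; apply: tringP => m; rewrite tfunD tfunN /= coefB; case: ifP;
  rewrite ?subr0.
Qed.
HB.instance Definition _ n := GRing.isZmodMorphism.Build {poly T} T (dehomog n)
  (dehomog_is_zmod_morphism n).

Lemma homog_is_zmod_morphism n : zmod_morphism (homog n).
Proof.
move=> t u; apply/polyP => i; rewrite coefB !coef_poly; case: ifP => _;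
  rewrite ?subr0 //.
by rewrite raddfB.
Qed.
HB.instance Definition _ n := GRing.isZmodMorphism.Build T {poly T} (homog n)
  (homog_is_zmod_morphism n).

Lemma homogK n x : tdeg_le n x -> dehomog n (homog n x) = x.
Proof.
move=> /tdeg_leP xn; apply: thom_inj => m; rewrite thom_dehomog;
  case: leqP => [mn|/xn->//].
by rewrite coef_poly ltnS leq_subr subKn // (thom_id (@tdeg_thom _ _ _ _)).
Qed.

Lemma homogS n x : tdeg_le n x -> homog n.+1 x = 'X * homog n x.
Proof.
move=> /tdeg_leP xn; apply/polyP => -[|i]; rewrite coefXM !coef_poly //=.
by rewrite subn0 xn.
Qed.

Lemma homogMl m n (t : T) x : tdeg m t -> tdeg_le n x ->
  homog (m + n) (t * x) = t%:P * homog n x.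
Proof.
move=> tm /tdeg_leP xn; apply/polyP => i; rewrite coefCM !coef_poly !ltnS.
case: (leqP i n) => [ni|ni].
  by rewrite (leq_trans ni (leq_addl _ _)) -addnBA // (thomMl _ _ tm).
rewrite mulr0; case: ifP => // imn; apply: (thomMl_lt _ tm).
by rewrite ltn_subLR // addnC ltn_add2r.
Qed.

Lemma homogMr m n (t : T) x : tdeg m t -> tdeg_le n x ->
  homog (n + m) (x * t) = homog n x * t%:P.
Proof.
move=> tm /tdeg_leP xn; apply/polyP => i; rewrite coefMC !coef_poly !ltnS.
case: (leqP i n) => [ni|ni].
  by rewrite (leq_trans ni (leq_addr _ _)) -addnBAC // (thomMr _ _ tm).
rewrite mul0r; case: ifP => // imn; apply: (thomMr_lt _ tm).
by rewrite ltn_subLR // ltn_add2r.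
Qed.

Lemma dehomogX n q : dehomog n.+1 ('X * q) = dehomog n q.
Proof.
apply: thom_inj => m; rewrite !thom_dehomog coefXM.
have [mn|nm] := leqP m n.
  by rewrite leqW // subn_eq0 leqNgt ltnS mn /= subSn.
rewrite (eqP (_ : n.+1 - m == 0)%N) ?subn_eq0 //=; by rewrite thom0 if_same.
Qed.

Lemma dehomogX0 q : dehomog 0 ('X * q) = 0.
Proof.
by apply: thom_inj => m; rewrite thom_dehomog coefXM sub0n /= !thom0 if_same.
Qed.

Lemma dehomogMl m n (t : T) q : tdeg m t ->
  dehomog n (t%:P * q) = if (m <= n)%N then t * dehomog (n - m) q else 0.
Proof.
move=> tm; apply: thom_inj => k; rewrite thom_dehomog coefCM.
have [km|mk] := ltnP k m.
  rewrite (thomMl_lt _ tm km) if_same; case: ifP => _; last by rewrite thom0.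
  by rewrite (thomMl_lt _ tm km).
rewrite -[in X in if _ then X else _](subnKC mk) (thomMl _ _ tm).
case: (leqP m n) => [mn|nm]; last by rewrite leqNgt (leq_trans nm mk) thom0.
rewrite -[in RHS](subnKC mk) (thomMl _ _ tm) thom_dehomog.
rewrite leq_sub2rE //; case: ifP => _; last by rewrite mulr0.
by rewrite subnDA.
Qed.

Lemma dehomogMr m n (t : T) q : tdeg m t ->
  dehomog n (q * t%:P) = if (m <= n)%N then dehomog (n - m) q * t else 0.
Proof.
move=> tm; apply: thom_inj => k; rewrite thom_dehomog coefMC.
have [km|mk] := ltnP k m.
  rewrite (thomMr_lt _ tm km) if_same; case: ifP => _; last by rewrite thom0.
  by rewrite (thomMr_lt _ tm km).
rewrite -[in X in if _ then X else _](subnK mk) (thomMr _ _ tm).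
case: (leqP m n) => [mn|nm]; last by rewrite leqNgt (leq_trans nm mk) thom0.
rewrite -[in RHS](subnK mk) (thomMr _ _ tm) thom_dehomog.
rewrite leq_sub2rE //; case: ifP => _; last by rewrite mul0r.
by rewrite addnC subnDA.
Qed.

Lemma homog_dehomog_sum (q : {poly T}) :
  exists N, q = \sum_(n < N) homog n (dehomog n q).
Proof.
(* N exceeds the total degree i + k of every term t z^i of q with t of degree k. *)
pose N := (size q + \max_(i < size q) tsize (q`_i : T)%R)%N; exists N.
apply/polyP => i; apply: tringP => m; rewrite coef_sum tfun_sum.
have tE (n : nat) : ((homog n (dehomog n q))`_i : T) m =
    if n == (m + i)%N then (q`_i : T) m else 0.
  rewrite coef_poly ltnS; case: leqP => [ni|ni] /=.
    case: (eqVneq m (n - i)%N) => [->|mn].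
      by rewrite subnK // eqxx leq_subr subKn.
    by case: eqP => // nE; case/eqP: mn; rewrite nE addnK.
  by rewrite ltn_eqF // (leq_trans ni) ?leq_addl.
under eq_bigr do rewrite tE.
have [miN|Nmi] := ltnP (m + i) N.
  rewrite (bigD1 (Ordinal miN)) //= eqxx big1 ?addr0 // => n nmi.
  by case: eqP => // nE; case/eqP: nmi; apply: val_inj.
rewrite big1 => [|n _]; last by rewrite ltn_eqF // (leq_trans (ltn_ord n)).
have [iq|qi] := ltnP i (size q); last by rewrite nth_default.
apply: tsizeP; rewrite -(leq_add2r i) (leq_trans _ Nmi) // addnC leq_add ?(ltnW iq) //.
exact: (leq_bigmax (F := fun j : 'I_(size q) => tsize (q`_j : T)) (Ordinal iq)).
Qed.

End Homogenization.

(** * The ideal of the central extension in terms of the filtration *)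

Section CentralExtensionFiltration.
Local Open Scope classical_set_scope.
Variables (S : nzRingType) (A : conn_ring S) (R : submod (tA A)).
Variable alpha : tA A -> tA A.
Hypothesis relR : relation_bimodule R.
Hypothesis filR : filtered_morphism R alpha.
Local Notation V := (deg1 A).
Local Notation T := (tring V).
Local Notation filt := (filt R alpha).

(** Only the component of r of degree m + i contributes. The truncation at [tsize r] loses nothing:
    beyond it this component is zero, and [alpha] sends 0 to 0. *)
Lemma alpha_z_coef (r : T) i m : R r -> ((alpha_z alpha r)`_i : T) m =
  if i is 0 then r m else (alpha (thom (m + i) r) : T) m.
Proof.
move=> Rr; rewrite coef_poly; case: i => [|i]; first by case: ltnP => // r0;
  rewrite (tsizeP (leq_trans r0 (leq0n m))).
have th0 : (tsize r <= m + i.+1)%N -> (alpha (thom (m + i.+1) r) : T) m = 0.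
  move=> /tsizeP rmi; rewrite (_ : thom _ r = 0) ?(alpha0 filR) //.
  by apply: tringP => k /=; case: eqP => // ->.
case: ltnP => [ir|ri]; last by rewrite th0 // (leq_trans ri) ?leq_addl.
rewrite /= tfun_sum /=; have [mir|/[dup] rmi /th0 ->] := ltnP (m + i.+1) (tsize r).
  rewrite (bigD1 (Ordinal mir)) ?leq_addl //= addnK eqxx big1 ?addr0 // =>
    n /andP[ni nmi].
  by case: eqP => // mE; case/eqP: nmi; apply: val_inj; rewrite /= mE subnK.
rewrite big1 // => n ni; case: eqP => // mE; have := ltn_ord n.
by rewrite ltnNge (leq_trans rmi) // mE subnK.
Qed.

Lemma dehomog_alpha_z n (r : T) : R r ->
  dehomog n (alpha_z alpha r) = deform alpha n (thom n r).
Proof.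
move=> Rr; apply: tringP => m; rewrite /deform !tfunD tfunN /= alpha_z_coef //.
case: (ltngtP m n) => [mn|nm|->].
- rewrite subr0 add0r -(subnSK mn) -{2}(subnKC mn).
  by rewrite addSnnS.
- rewrite subr0 add0r; have [_ _ /(_ n (thom n r))] := filR.
  by move=> h; apply/esym/h => //; [exact: rel_thom|exact: tdeg_thom].
- by rewrite subnn subrr addr0.
Qed.

Lemma homog_deform n (r : T) : R r -> tdeg n r ->
  homog n (deform alpha n r) = alpha_z alpha r.
Proof.
move=> Rr rn; apply/polyP => i; apply: tringP => m;
  rewrite alpha_z_coef // coef_poly ltnS.
have [ni|ni] := leqP i n; last first.
  case: i ni => [//|i] ni; rewrite (thom_eq0 rn) ?(alpha0 filR) // gtn_eqF //.
  by rewrite (leq_trans ni) ?leq_addl.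
rewrite -[LHS]/(if m == (n - i)%N then deform alpha n r m else 0).
rewrite /deform !tfunD tfunN /=; case: i ni => [|i] ni.
  rewrite subn0; case: eqP => [->|/eqP mn]; first by rewrite subrr addr0.
  by rewrite rn.
case: (eqVneq m (n - i.+1)%N) => [->|mn].
  rewrite subnK // (thom_id rn) rn ?add0r;
    last by rewrite ltn_eqF // ltn_subrL (leq_trans _ ni).
  by rewrite ltn_eqF ?subr0 // ltn_subrL (leq_trans _ ni).
rewrite (thom_eq0 rn) ?(alpha0 filR) //; apply: contraNneq mn => <-.
by rewrite addnK.
Qed.

Local Notation X := [set p | exists r : tA A, R r /\ p = alpha_z alpha r].
Local Notation J := (span (@ideal_gens {poly tA A} X)).

(** The polynomials whose degree n part lies in F_n for every n form a two-sided ideal: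
    multiplication by z corresponds to [filt_S], by homogeneous coefficients to [filtMl] and
    [filtMr]. This ideal contains the generators. *)
Lemma ideal_dehomog (q : {poly tA A}) : J q -> forall n, filt n (dehomog n q).
Proof.
pose K (q : {poly T}) := forall n, filt n (dehomog n q).
have K0 : K 0 by move=> n; rewrite raddf0; exact: filt0.
have KB p1 p2 : K p1 -> K p2 -> K (p1 - p2).
  by move=> K1 K2 n; rewrite raddfB; exact: filtB.
have KD p1 p2 : K p1 -> K p2 -> K (p1 + p2).
  by move=> K1 K2 n; rewrite raddfD; exact: filtD.
have KX p : K p -> K ('X * p).
  move=> Kp [|n]; first by rewrite dehomogX0; exact: filt0.
  by rewrite dehomogX; exact: filt_S.
have KCl c p : K p -> K (c%:P * p).
  move=> Kp; elim/tring_hom_ind: c => [|t u Kt Ku|k t tk].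
  - by rewrite polyC0 mul0r.
  - by rewrite polyCD mulrDl; exact: KD.
  move=> n; rewrite (dehomogMl _ _ tk); case: leqP => [kn|_]; last exact: filt0.
  by rewrite -[n in filt n](subnKC kn); exact: filtMl.
have KCr c p : K p -> K (p * c%:P).
  move=> Kp; elim/tring_hom_ind: c => [|t u Kt Ku|k t tk].
  - by rewrite polyC0 mulr0.
  - by rewrite polyCD mulrDr; exact: KD.
  move=> n; rewrite (dehomogMr _ _ tk); case: leqP => [kn|_]; last exact: filt0.
  by rewrite -[n in filt n](subnK kn); exact: filtMr.
have Kl a p : K p -> K (a * p).
  move=> Kp; elim/poly_ind: a => [|a c Ka]; first by rewrite mul0r.
  by rewrite mulrDl commr_polyX -mulrA; apply: KD; [exact: KX|exact: KCl].
have Kr a p : K p -> K (p * a).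
  move=> Kp; elim/poly_ind: a => [|a c Ka]; first by rewrite mulr0.
  by rewrite mulrDr mulrA commr_polyX; apply: KD; [exact: KX|exact: KCr].
move=> Jq; rewrite -/(K q);
  elim: Jq => [_ [a [_ [b [[r [Rr ->]] ->]]]]||x y _ Kx _ Ky] //.
  apply: Kr; apply: Kl => n; rewrite dehomog_alpha_z //.
  by apply: filt_rel; [exact: rel_thom|exact: tdeg_thom].
exact: KB.
Qed.

Lemma ideal_homog n x : filt n x -> J (homog n x).
Proof.
elim=> [{}n r Rr rn|{}n {}x xn IH|{}n v {}x xn IH|{}n v {}x xn IH
  |{}n {}x y _ IHx _ IHy].
- rewrite homog_deform //; apply: span_gen; exists 1, (alpha_z alpha r), 1.
  by rewrite mul1r mulr1; split=> //; exists r.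
- by rewrite homogS; [exact: ideal_mull|exact: filt_le xn].
- by rewrite -add1n (homogMl (tdeg_iota v)); [exact: ideal_mull|exact: filt_le xn].
- by rewrite -addn1 (homogMr (tdeg_iota v)); [exact: ideal_mulr|exact: filt_le xn].
- by rewrite raddfB; exact: span_B.
Qed.

Lemma ideal_dehomogP (q : {poly tA A}) : (forall n, filt n (dehomog n q)) -> J q.
Proof.
move=> qF; have [N ->] := homog_dehomog_sum q.
by apply: span_sum => i _; exact: ideal_homog.
Qed.

(* Multiplication by z is injective on the degree n part of the central
   extension, which is T^{<= n} / F_n. *)
Definition filt_reg n := forall x : T, filt n.+1 x -> tdeg_le n x -> filt n x.

Lemma ext_regularP : (forall n, filt_reg n) -> ext_regular R alpha.
Proof.
move=> regF; elim/ring_quot_ind => q.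
rewrite /ext_ann /= /ext_z /ext_pi => zq.
have {}zq : J ('X * q) by apply/span_pi0; rewrite -[RHS]zq; exact/esym/quot_mul_pi.
apply/(span_pi0 _ q)/ideal_dehomogP => n; apply: regF.
  by rewrite -dehomogX; exact: ideal_dehomog.
by move=> m nm /=; rewrite leqNgt nm.
Qed.

(** [homog n x] has total degree n, hence its class lies in D^{<= c}; z kills this class because x
    is in F_{n+1}. *)
Lemma filt_reg_ext (c : nat) n : (n <= c)%N ->
  ext_n_regular R alpha c%:Z%:E -> filt_reg n.
Proof.
move=> nc regc x xS xn; rewrite -(homogK xn); apply: ideal_dehomog.
apply/span_pi0; apply: regc.
  apply: etrans (quot_mul_pi _ _ _) _; apply/span_pi0.
  by rewrite -homogS //; exact: ideal_homog.
exists (homog n x) => // i k nik; rewrite coef_poly.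
case: ltnP => // ni /=; case: eqP => // kE; move: nik.
by rewrite kE subnKC // ltz_nat ltnNge nc.
Qed.

End CentralExtensionFiltration.

(** * Tensor products over S with A *)

Section TensorOverConnected.
Local Open Scope classical_set_scope.
Variables (S : nzRingType) (A : conn_ring S).
Hypothesis strA : strongly_graded A.
Local Notation V := (deg1 A).
Local Notation T := (tring V).
Local Notation "a '⊗' v" := (pure (a : conn_bimod A) v) (at level 40).

Lemma pure_scale (M : lmodType S) (a b : A) (v : M) : a *: (b ⊗ v) = (a * b) ⊗ v.
Proof. exact: tens_scale_pure. Qed.

Lemma pure_scalar (M : lmodType S) (a : A) s (v : M) : (a * s%:A) ⊗ v = a ⊗ (s *: v).
Proof. exact: (pure_ract (a : conn_bimod A)). Qed.

Lemma pure_is_zmod_morphism (M : lmodType S) (a : A) :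
  zmod_morphism (fun v : M => a ⊗ v).
Proof. by move=> v w; apply/eqP; rewrite eq_sym subr_eq -pureDr subrK. Qed.

Lemma pure0r (M : lmodType S) (a : A) : a ⊗ (0 : M) = 0.
Proof. by rewrite -(subrr (0 : M)) pure_is_zmod_morphism subrr. Qed.

Lemma pureBl (M : lmodType S) (a b : A) (v : M) : (a - b) ⊗ v = a ⊗ v - b ⊗ v.
Proof. by apply/eqP; rewrite eq_sym subr_eq -pureDl subrK. Qed.

Lemma pure0l (M : lmodType S) (v : M) : (0 : A) ⊗ v = 0.
Proof. by rewrite -(subrr (0 : A)) pureBl subrr. Qed.

Lemma pure_sumr (M : lmodType S) (a : A) (I : Type) (r : seq I) (F : I -> M) :
  a ⊗ (\sum_(i <- r) F i) = \sum_(i <- r) a ⊗ F i.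
Proof. exact: (big_morph (fun v => a ⊗ v) (pureDr _) (pure0r _ _)). Qed.

Lemma tens_hom_ind (M : grmod S) (P : tens (conn_bimod A) M -> Prop) :
  P 0 -> (forall x y, P x -> P y -> P (x - y)) ->
  (forall i j (t : T) v, tdeg i t -> grmod_deg M j v -> P (piA t ⊗ v)) ->
  forall x, P x.
Proof.
move=> P0 PB Ph; have PD x y : P x -> P y -> P (x + y).
  by move=> Px Py; rewrite -[y]opprK; apply: (PB) => //; rewrite -sub0r; exact: PB.
elim/tens_ind => // b v; have [t <-] := piA_surj strA b.
elim/tring_hom_ind: t => [|t u Pt Pu|i t ti]; first by rewrite raddf0 pure0l.
  by rewrite raddfD pureDl; exact: PD.
elim/(graded_ind (@grmod_grading _ M)): v => [|x y Px Py|j v vj];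
  first by rewrite pure0r.
  by rewrite pureDr; exact: PD.
exact: Ph ti vj.
Qed.

Lemma tens_deg_ind (M : lmodType S) (H : nat -> set M) m
    (P : tens (conn_bimod A) M -> Prop) :
  P 0 -> (forall x y, P x -> P y -> P (x - y)) ->
  (forall i j (t : T) v, (i + j)%N = m -> tdeg i t -> H j v -> P (piA t ⊗ v)) ->
  forall x, tens_deg H m x -> P x.
Proof.
move=> P0 PB Ph x; elim=> [_ [i [j [a [v [ijm ai vj ->]]]]]||y z _ Py _ Pz] //;
  last exact: PB.
by have [t [ti <-]] := piA_surj_deg strA ai; exact: Ph ijm ti vj.
Qed.

Lemma tens_deg_pure (M : lmodType S) (H : nat -> set M) i j (t : T) v :
  tdeg i t -> H j v -> tens_deg H (i + j) (piA t ⊗ v).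
Proof.
by move=> ti vj; apply: span_gen; exists i, j, (piA t), v; split=> //; exact: piA_deg.
Qed.

Section Lift.
Variables (M : lmodType S) (X : set T) (g : T -> M -> T).

(** A map on A ⊗ M is given by a formula on lifts to T of elements of A. The lift is picked by
    choice, which is harmless as soon as g sends I into the span of X. *)
Definition tens_lift : tens (conn_bimod A) M -> span_quot X :=
  tlift (fun (a : conn_bimod A) v => span_pi X (g (sval (cid (piA_surj strA a))) v)).

Hypothesis gBl : forall t u v, g (t - u) v = g t v - g u v.
Hypothesis gDr : forall t v w, g t (v + w) = g t v + g t w.
Hypothesis gS : forall t s v, g (t * s%:A) v = g t (s *: v).
Hypothesis gI : forall t v, IA t -> span X (g t v).

Lemma tens_lift_welldef t u v : piA t = piA u -> span_pi X (g t v) = span_pi X (g u v).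
Proof.
move=> tu; apply/span_pi_eq; rewrite -gBl; apply: gI.
by rewrite /IA /= raddfB /= tu subrr.
Qed.

Lemma tens_lift_balanced :
  balanced (fun (a : conn_bimod A) v => span_pi X (g (sval (cid (piA_surj strA a))) v)).
Proof.
have gDl t u v : g (t + u) v = g t v + g u v.
  by have := gBl (t + u) u v; rewrite addrK => ->; rewrite subrK.
split=> [b c m|b m n|b s m].
- rewrite -raddfD -gDl; apply: tens_lift_welldef.
  by rewrite raddfD /=; do 3 case: cid => ? /= ->.
- by rewrite gDr raddfD.
- rewrite -gS; apply: tens_lift_welldef.
  by rewrite piAM piA_scalar; do 2 case: cid => ? /= ->.
Qed.

Lemma tens_lift_pure t v : tens_lift (piA t ⊗ v) = span_pi X (g t v).
Proof.
rewrite /tens_lift (tlift_pure tens_lift_balanced).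
by apply: tens_lift_welldef; case: cid.
Qed.

Lemma tens_liftB x y : tens_lift (x - y) = tens_lift x - tens_lift y.
Proof. exact: tliftB tens_lift_balanced _ _. Qed.

End Lift.

Definition IAV : set T := [set y | exists u (v : V), IA u /\ y = u * iota_t v].

Lemma IAV_mul (u : T) v : IA u -> span IAV (u * iota_t v).
Proof. by move=> uI; apply: span_gen; exists u, v. Qed.

Lemma IAV_thom n y : span IAV y -> span IAV (thom n y).
Proof.
apply: (span_map (f := @thom S V n)) => _ [u [v [uI ->]]] /=.
case: n => [|n]; first by rewrite (thomMr_lt _ (tdeg_iota v)) //; exact: span_0.
by rewrite -addn1 (thomMr _ _ (tdeg_iota v)); exact/IAV_mul/IA_thom.
Qed.

Lemma IAV_mull t y : span IAV y -> span IAV (t * y).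
Proof.
by apply: span_mull => _ [u [v [uI ->]]]; rewrite mulrA; exact/IAV_mul/IAMl.
Qed.

(** This turns membership in I V into the vanishing in A of all coefficients with respect to a dual
    basis. *)
Lemma IAV_rcontract (phi : {linear V -> S^o}) y : span IAV y -> IA (rcontract phi y).
Proof.
elim=> [_ [u [v [uI ->]]]||x z _ IHx _ IHz].
- by rewrite rcontractM; exact: IAMr.
- by rewrite raddf0; exact: IA0.
- by rewrite raddfB; exact: IAB.
Qed.

(* The degree n part of the isomorphism A ⊗ V = T^+ / (I V). *)
Definition kappa n : tens (conn_bimod A) V -> span_quot IAV :=
  tens_lift IAV (fun t v => thom n (t * iota_t v)).

Lemma kappa_hyps n :
  [/\ forall t u (v : V), thom n ((t - u) * iota_t v) =
    thom n (t * iota_t v) - thom n (u * iota_t v),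
      forall (t : T) (v w : V), thom n (t * iota_t (v + w)) =
        thom n (t * iota_t v) + thom n (t * iota_t w),
      forall (t : T) s (v : V), thom n (t * s%:A * iota_t v) =
        thom n (t * iota_t (s *: v))
    & forall (t : T) v, IA t -> span IAV (thom n (t * iota_t v))].
Proof.
split=> [t u v|t v w|t s v|t v tI].
- by rewrite mulrBl raddfB.
- by rewrite raddfD mulrDr raddfD.
- by rewrite iota_tZ mul_scalar_t.
- exact/IAV_thom/IAV_mul.
Qed.

Lemma kappa_pure n (t : T) v : kappa n (piA t ⊗ v) =
  span_pi IAV (thom n (t * iota_t v)).
Proof. by case: (kappa_hyps n) => h1 h2 h3 h4; exact: tens_lift_pure. Qed.
Lemma kappaB n x y : kappa n (x - y) = kappa n x - kappa n y.
Proof. by case: (kappa_hyps n) => h1 h2 h3 h4; exact: tens_liftB. Qed.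
Lemma kappa0 n : kappa n 0 = 0.
Proof. by rewrite -(subrr 0) kappaB subrr. Qed.

Lemma kappaD n x y : kappa n (x + y) = kappa n x + kappa n y.
Proof. by rewrite -[y in LHS]opprK -[- y]sub0r !kappaB kappa0 sub0r opprK. Qed.

Lemma kappa_scale n i (b t : T) y : tdeg i b -> kappa n y = span_pi IAV t ->
  kappa (i + n) (piA b *: y) = span_pi IAV (b * t).
Proof.
(* One representative satisfying both equations suffices, since I V is stable under left
   multiplication. *)
move=> bi yt; suff [t' [yt' byt']] : exists t', kappa n y = span_pi IAV t' /\
    kappa (i + n) (piA b *: y) = span_pi IAV (b * t').
  rewrite byt'; apply/span_pi_eq; rewrite -mulrBr; apply: IAV_mull.
  by apply/span_pi_eq; rewrite -yt -yt'.
elim/tens_ind: y {yt} => [|x y [u [xu bxu]] [w [yw byw]]|a v].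
- by exists 0; rewrite scaler0 !kappa0 mulr0 raddf0.
- by exists (u - w); rewrite scalerBr !kappaB xu yw bxu byw mulrBr !raddfB.
have [u <-] := piA_surj strA a; exists (thom n (u * iota_t v)).
by rewrite pure_scale -piAM !kappa_pure -mulrA (thomMl _ _ bi).
Qed.

Local Notation degV := (tens_deg (fun j (_ : V) => j = 1%N)).

Lemma kappa_eq0 m n y : degV m y -> m != n -> kappa n y = 0.
Proof.
move=> ym mn; elim/tens_deg_ind: ym => [|x z x0 z0|i j t v ijm ti j1].
- exact: kappa0.
- by rewrite kappaB x0 z0 subr0.
rewrite kappa_pure (thom_eq0 (tdegM ti (tdeg_iota v))) ?raddf0 //.
by rewrite -{1}j1 ijm eq_sym.
Qed.

Section Multiplication.
Variable D0 : {linear tens (conn_bimod A) V -> A^o}.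
Hypothesis D0E : forall (a : A) (x : V), D0 (a ⊗ x) = a * deg1_val x.
Hypothesis projV : projective V.

(** The last clause is the injectivity of [kappa n] in degree n: y is rebuilt from the contractions
    of t by a dual basis, and these lie in I when t is in I V. *)
Lemma kappa_homP n y : degV n y ->
  exists t, [/\ tdeg n t, kappa n y = span_pi IAV t, D0 y = piA t
              & kappa n y = 0 -> y = 0].
Proof.
(* The formula for y is asked for every family [l] adequate for [ws], so that for a difference the
   two lists can be concatenated and the same [l] used; the dual basis is chosen only afterwards. *)
move=> yn; suff [t [tn yt D0t [ws wsP]]] :
    exists t, [/\ tdeg n t, kappa n y = span_pi IAV t, D0 y = piA t
      & exists ws : seq V, forall l : seq ({linear V -> S^o} * V),
          (forall w, w \in ws -> w = \sum_(p <- l) p.1 w *: p.2) ->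
          y = \sum_(p <- l) piA (rcontract p.1 t) ⊗ p.2].
  exists t; split=> //; rewrite yt => /span_pi0 tI.
  have [l /wsP ->] := projective_dual_basis projV ws.
  by rewrite big1 // => p _; rewrite (IAV_rcontract _ tI) pure0l.
elim/tens_deg_ind: yn => [|x z [t [tn xt D0t [ws wsP]]] [u [un zu D0u [ws' wsP']]]
  |i j t v ijn ti j1].
- exists 0; rewrite kappa0 !raddf0; split=> //; exists [::] => l _.
  by rewrite big1 // => p _; rewrite !raddf0 pure0l.
- exists (t - u); rewrite kappaB xt zu !raddfB /= D0t D0u; split=> //;
  first exact: tdegB.
  exists (ws ++ ws') => l lP; rewrite {1}(wsP l) ?{1}(wsP' l) => [|w ws_w|w ws_w];
    last 2 first.
  + by apply: lP; rewrite mem_cat ws_w orbT.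
  + by apply: lP; rewrite mem_cat ws_w.
  by rewrite -sumrB; apply: eq_bigr => p _; rewrite !raddfB /= pureBl.
have tvn : tdeg n (t * iota_t v) by rewrite -ijn j1; exact: tdegM ti (tdeg_iota v).
exists (t * iota_t v); split=> //; first by rewrite kappa_pure (thom_id tvn).
  by rewrite D0E piAM piA_iota.
exists [:: v] => l lP; rewrite {1}(lP v) ?inE // pure_sumr; apply: eq_bigr => p _.
by rewrite rcontractM piAM piA_scalar pure_scalar.
Qed.

Lemma kappa_ex n t : tdeg n.+1 t ->
  exists y, kappa n.+1 y = span_pi IAV t /\ D0 y = piA t.
Proof.
move/tdegSr; elim=> [_ [u [v [un ->]]]||t1 t2 _ [x [xt x0]] _ [y [yt y0]]].
- exists (piA u ⊗ v); rewrite kappa_pure D0E piAM piA_iota -addn1.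
  by rewrite (thomMr _ _ (tdeg_iota v)) (thom_id un).
- by exists 0; rewrite kappa0 !raddf0.
- by exists (x - y); rewrite kappaB xt yt !raddfB /= x0 y0.
Qed.

End Multiplication.
End TensorOverConnected.

(** * Regularity *)

Section Regularity.
Local Open Scope classical_set_scope.
Variables (S : nzRingType) (A : conn_ring S) (R : submod (tA A)).
Variable alpha : tA A -> tA A.
Hypothesis strA : strongly_graded A.
Hypothesis relR : relation_bimodule R.
Hypothesis filR : filtered_morphism R alpha.
Local Notation V := (deg1 A).
Hypothesis projV : projective V.
Local Notation T := (tring V).
Local Notation "a '⊗' v" := (pure (a : conn_bimod A) v) (at level 40).
Local Notation filt := (filt R alpha).
Local Notation kappa := (@kappa S A strA).
Local Notation IAV := (@IAV S A).

Definition filtV n : set T := [set y | exists f (v : V), filt n f /\ y = f * iota_t v].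

Lemma filtV_filt n y : span (filtV n) y -> filt n.+1 y.
Proof. by apply: filt_span => // _ [f [v [fn ->]]]; exact: filt_Mv. Qed.

Lemma filtV_IAV n y : span (filtV n) y -> span IAV (thom n.+1 y).
Proof.
apply: (span_map (f := @thom S V n.+1)) => _ [f [v [fn ->]]] /=.
by rewrite -addn1 (thomMr _ _ (tdeg_iota v)); apply/IAV_mul/(filt_symbol relR filR).
Qed.

Lemma IAV_lift n y : span IAV y ->
  exists w, span (filtV n) w /\ thom n.+1 w = thom n.+1 y.
Proof.
elim=> [_ [u [v [uI ->]]]||t1 t2 _ [x [xt x0]] _ [z [zt z0]]].
- have [x [xn xu]] := IA_lift relR filR (@IA_thom _ _ n u uI) (@tdeg_thom _ _ n u).
  exists (x * iota_t v); split; first by apply: span_gen; exists x, v.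
  by rewrite -addn1 !(thomMr _ _ (tdeg_iota v)) xu.
- by exists 0; split=> //; exact: span_0.
- by exists (x - z); rewrite !raddfB /= x0 z0; split=> //; exact: span_B.
Qed.

(* V is flat, so F_n ⊗ V meets T^{<= n-1} ⊗ V in (F_n ∩ T^{<= n-1}) ⊗ V: the
   contractions by a dual basis detect membership in these submodules. *)
Lemma filtV_le n y : (forall m, n = m.+1 -> filt_reg R alpha m) ->
  span (filtV n) y -> tdeg_le n y -> filt n y.
Proof.
case: n => [_ y0 _|n /(_ n erefl) regn yV yn].
  suff -> : y = 0 by exact: filt0.
  elim: y0 => [_ [f [v [/(filt_0 relR filR)-> ->]]]||_ _ _ -> _ ->] //;
    first by rewrite mul0r.
  by rewrite subr0.
have [ws wsP] : exists ws : seq V, forall l : seq ({linear V -> S^o} * V),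
    (forall w, w \in ws -> w = \sum_(p <- l) p.1 w *: p.2) ->
    y = \sum_(p <- l) rcontract p.1 y * iota_t p.2.
  elim: yV {yn} => [_ [f [v [fn ->]]]||x z _ [ws wsP] _ [ws' wsP']].
  - exists [:: v] => l lP; rewrite {1}(lP v) ?inE // raddf_sum mulr_sumr.
    by apply: eq_bigr => p _; rewrite rcontractM /= iota_tZ mul_scalar_t.
  - by exists [::] => l _; rewrite big1 // => p _; rewrite raddf0 mul0r.
  exists (ws ++ ws') => l lP.
  have xE : x = \sum_(p <- l) rcontract p.1 x * iota_t p.2.
    by apply: wsP => w ws_w; apply: lP; rewrite mem_cat ws_w.
  have zE : z = \sum_(p <- l) rcontract p.1 z * iota_t p.2.
    by apply: wsP' => w ws_w; apply: lP; rewrite mem_cat ws_w orbT.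
  rewrite [LHS](congr2 (fun a b => a - b) xE zE) -sumrB.
  by apply: eq_bigr => p _; rewrite raddfB /= mulrBl.
have [l /wsP ->] := projective_dual_basis projV ws.
apply: filt_sum => // p _; apply: filt_Mv; apply: regn; last exact: tdeg_le_rcontract.
elim: yV => [_ [f [v [fn ->]]]||x z _ xn _ zn].
- by rewrite rcontractM; exact: filt_scalar.
- by rewrite raddf0; exact: filt0.
- by rewrite raddfB; exact: filtB.
Qed.

Definition filtQ n : set T := [set y | filt n y \/ filtV n y].

Lemma filtQP n y : span (filtQ n) y ->
  exists f w, [/\ filt n f, span (filtV n) w & y = f + w].
Proof.
elim=> [x [xn|xV]||x z _ [f [w [fn wn ->]]] _ [f' [w' [fn' wn' ->]]]].
- by exists x, 0; rewrite addr0; split=> //; exact: span_0.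
- by exists 0, x; rewrite add0r; split=> //; [exact: filt0|exact: span_gen].
- by exists 0, 0; rewrite addr0; split=> //; [exact: filt0|exact: span_0].
- exists (f - f'), (w - w'); rewrite opprD addrACA; split=> //;
  [exact: filtB|exact: span_B].
Qed.

Lemma filtQ_filt n y : filt n y -> span (filtQ n) y.
Proof. by move=> yn; apply: span_gen; left. Qed.
Lemma filtQ_V n y : span (filtV n) y -> span (filtQ n) y.
Proof. by apply: span_sub => z zV; apply: span_gen; right. Qed.

Lemma filtQ_IAV n y : span (filtQ n) y -> span IAV (thom n.+1 y).
Proof.
move=> /filtQP[f [w [fn /filtV_IAV wn ->]]]; rewrite raddfD /=.
by rewrite (iffLR (tdeg_leP _ _) (filt_le filR fn)) ?add0r.
Qed.

(* Write u = U - (U - u) with U in F_i of symbol u. Then U x is in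
   F_n V + F_n because the components of x of positive degree are in T V, and
   (U - u) x is in F_n because U - u has degree < i. *)
Lemma IA_filt_mul n i j (u x : T) : (i + j = n.+1)%N -> tdeg i u -> IA u -> filt j x ->
  span (filtQ n) (u * x).
Proof.
move=> ijn ui uI xj; case: j ijn xj => [|j] ijn xj.
  by rewrite (filt_0 relR filR xj) mulr0; exact: span_0.
have {}ijn : (i + j)%N = n by move: ijn; rewrite addnS => -[].
have [U [Ui Uu]] := IA_lift relR filR uI ui.
rewrite -[u](subKr U) mulrBl; apply: span_B.
  rewrite (tdeg_le_sum (filt_le filR xj)) mulr_sumr; apply: span_sum => -[[|k] kj] _ /=.
    have /tdeg0P[s ->] := @tdeg_thom _ _ 0 x.
    by apply/filtQ_filt/filt_scalar => //; apply: filtW Ui; rewrite -ijn leq_addr.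
  apply: filtQ_V; have : tdeg k.+1 (thom k.+1 x) by exact: tdeg_thom.
  move/tdegSr; apply: span_mull => _ [y [v [yk ->]]]; apply: span_gen.
  exists (U * y), v; rewrite mulrA; split=> //.
  apply: (@filtW _ _ _ _ (i + k)); last exact: filtMr.
  by rewrite -ijn leq_add2l -ltnS.
case: i ui Ui Uu ijn => [|i] ui Ui Uu ijn.
  by rewrite -Uu (filt_0 relR filR Ui) raddf0 subr0 mul0r; exact: span_0.
apply: filtQ_filt; have Uui : tdeg_le i (U - u).
  apply/tdeg_leP => m im; rewrite raddfB /=; case: (eqVneq m i.+1) => [->|mi].
    by rewrite Uu (thom_id ui) subrr.
  rewrite (thom_eq0 ui mi) subr0; apply: (iffLR (tdeg_leP _ _) (filt_le filR Ui)).
  by rewrite ltn_neqAle eq_sym mi.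
rewrite (tdeg_le_sum Uui) mulr_suml; apply: filt_sum => // k _.
apply: (@filtW _ _ _ _ (k + j.+1)); last by apply: filtMl => //; exact: tdeg_thom.
by rewrite -ijn addSnnS leq_add2r -ltnS.
Qed.

(** * Lifting the differential on A ⊗ V_2 to the filtration *)

Section Differentials.
Variables (M2 M3 : grmod S).
Variable D0 : {linear tens (conn_bimod A) V -> A^o}.
Variable D1 : {linear tens (conn_bimod A) M2 -> tens (conn_bimod A) V}.
Variable D2 : {linear tens (conn_bimod A) M3 -> tens (conn_bimod A) M2}.
Local Notation degV := (tens_deg (fun j (_ : V) => j = 1%N)).
Local Notation deg2 := (tens_deg (fun j => grmod_deg M2 j)).
Local Notation deg3 := (tens_deg (fun j => grmod_deg M3 j)).
Hypothesis projM2 : projective M2.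
Hypothesis D0E : forall (a : A) (x : V), D0 (a ⊗ x) = a * deg1_val x.
Hypothesis D1_deg : forall m x, deg2 m x -> degV m (D1 x).
Hypothesis D2_deg : forall m x, deg3 m x -> deg2 m (D2 x).
Hypothesis D01 : forall y, (exists x, D1 x = y) <-> D0 y = 0.
Hypothesis D12 : forall y, (exists x, D2 x = y) <-> D1 y = 0.

Let D1Z (a : A) x : D1 (a *: x) = a *: D1 x.
Proof. exact: linearZ. Qed.
Let D2Z (a : A) x : D2 (a *: x) = a *: D2 x.
Proof. exact: linearZ. Qed.

Lemma pure1_deg j v : grmod_deg M2 j v -> deg2 j (1 ⊗ v).
Proof.
by move=> vj; rewrite -(piA1 A); exact: (tens_deg_pure (i := 0) (@tone_deg _ _) vj).
Qed.

(** As [D0] kills [D1 (1 ⊗ v)], the representative of the latter in T^j lies in I, hence is the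
    symbol of an element of F_j. *)
Lemma D1_lift j v : grmod_deg M2 j v ->
  exists m, filt j m /\ kappa j (D1 (1 ⊗ v)) = span_pi IAV (thom j m).
Proof.
move=> /pure1_deg/D1_deg/(kappa_homP strA D0E projV)[t [tj kt D0t _]].
have tI : IA t by rewrite /IA /= -D0t; apply/D01; eexists.
have [m [mj mt]] := IA_lift relR filR tI tj; exists m; split=> //.
by rewrite mt.
Qed.

Local Notation comp := (gcomp (@grmod_grading _ M2)).

(* M2 is lifted through the fibre product over A ⊗ V of F_j, mapped by its
   symbols, and of M2, mapped by D1 on its degree j part. *)
Lemma filt_lift_ex j : exists G : {linear M2 -> T},
  forall v, filt j (G v) /\ kappa j (D1 (1 ⊗ comp v j)) = span_pi IAV (thom j (G v)).
Proof.
have compP a v w : comp (a *: v + w) j =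
  a *: comp v j + comp w j by exact: gcomp_linear.
pose U (x : T * M2) := filt j x.1 /\
  kappa j (D1 (1 ⊗ comp x.2 j)) = span_pi IAV (thom j x.1).
have U0 : U 0.
  split; first exact: filt0.
  have -> : comp 0 j = 0 by have := compP (-1) 0 0; rewrite !scaleN1r oppr0 addr0 addNr.
  by rewrite pure0r !raddf0 kappa0.
have UL a x y : U x -> U y -> U (a *: x + y).
  move=> [xj xU] [yj yU]; split; first by apply: filtD => //; exact: filtZ.
  rewrite -[(a *: x + y).2]/(a *: x.2 + y.2) -[(a *: x + y).1]/(a *: x.1 + y.1).
  rewrite compP pureDr linearD kappaD -pure_scalar.
  have -> : 1 * a%:A = a%:A * 1 :> A by rewrite mul1r mulr1.
  rewrite -pure_scale D1Z -(piA_scalar A) (kappa_scale (tdeg_scalar _ _) xU) yU.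
  by rewrite -raddfD -scalerAM mul1r [thom j (_ + _)]raddfD /= thomZ.
pose g (x : sub_of (Submod U0 UL)) := (sub_val x).2.
have gL : linear g by [].
have [|h hK] := @projM2 _ _ (linear_pack gL) (idfun : {linear M2 -> M2}).
  move=> v; have [m [mj mv]] := D1_lift (gcomp_deg (@grmod_grading _ M2) v j).
  have mvU : (m, v) \in in_submod (Submod U0 UL) by apply/asboolP.
  by exists (SubOf mvU).
have GL : linear (fun v => (sub_val (h v)).1) by move=> a v w; rewrite linearP.
exists (linear_pack GL) => v; have /asboolP := sub_valP (h v).
by rewrite /= /U -[(sub_val (h v)).2]/(g (h v)) [g _](hK v).
Qed.

Lemma filt_lift : exists G : nat -> {linear M2 -> T},
  [/\ forall j v, filt j (G j v),
      forall j v, grmod_deg M2 j v ->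
        kappa j (D1 (1 ⊗ v)) = span_pi IAV (thom j (G j v)),
      forall i j v, grmod_deg M2 i v -> j != i -> G j v = 0
    & forall j v, G j (comp v j) = G j v].
Proof.
have [H HP] := choice filt_lift_ex.
(* Composing with the projection onto degree j makes the j-th lift vanish on all other degrees. *)
have GL j : linear (fun v => H j (comp v j)).
  by move=> a v w; rewrite gcomp_linear linearP.
have compK j v : comp (comp v j) j = comp v j by exact/gcomp_id/gcomp_deg.
exists (fun j => linear_pack (GL j)); split=> [j v|j v vj|i j v vi ji|j v] /=.
- by have [] := HP j (comp v j).
- by have [_ <-] := HP j (comp v j); rewrite compK gcomp_id.
- by rewrite (gcomp_hom _ vi) (negPf ji) linear0.
- by rewrite compK.
Qed.

(** * Generators of the filtration indexed by V_2, and their syzygies *)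

Section Generators.
Variable G : nat -> {linear M2 -> T}.
Hypothesis G_filt : forall j v, filt j (G j v).
Hypothesis G_symbol : forall j v, grmod_deg M2 j v ->
  kappa j (D1 (1 ⊗ v)) = span_pi IAV (thom j (G j v)).
Hypothesis G_eq0 : forall i j v, grmod_deg M2 i v -> j != i -> G j v = 0.
Hypothesis G_comp : forall j v, G j (comp v j) = G j v.

Definition genG n : set T := [set y | exists i j (t : T) v,
  [/\ (i + j = n)%N, tdeg i t & y = t * G j v]].

Lemma genG_filt n y : span (genG n) y -> filt n y.
Proof.
by apply: filt_span => // _ [i [j [t [v [<- ti ->]]]]]; exact: filtMl.
Qed.

(** The part of weight n of the product of t with all G_j(v). Summing over every splitting of n
    keeps it additive in t and v without homogeneity assumptions. *)
Definition Phi_rep n (t : T) v := \sum_(j < n.+1) thom (n - j) t * G j v.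

Lemma Phi_rep_hom n i (t : T) v : tdeg i t -> (i <= n)%N ->
  Phi_rep n t v = t * G (n - i)%N v.
Proof.
move=> ti ni; have jn : (n - i < n.+1)%N by rewrite ltnS leq_subr.
rewrite /Phi_rep (bigD1 (Ordinal jn)) //= subKn // (thom_id ti) big1 ?addr0 // => j ji.
rewrite (thom_eq0 ti) ?mul0r //; apply: contraNneq ji => iE.
by apply/eqP/val_inj; rewrite /= -iE subKn // -ltnS.
Qed.

Lemma Phi_rep_gt n i (t : T) v : tdeg i t -> (n < i)%N -> Phi_rep n t v = 0.
Proof.
move=> ti ni; rewrite /Phi_rep big1 // => j _; rewrite (thom_eq0 ti) ?mul0r //.
by rewrite ltn_eqF // (leq_ltn_trans _ ni) // leq_subr.
Qed.

(* On the part of degree n+1 it sends a ⊗ v to the class of t G_j(v) modulo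
   F_n + F_n V, where t is a lift of a; it vanishes in the other degrees. *)
Definition Phi n := tens_lift strA (filtQ n) (Phi_rep n.+1).

Lemma Phi_hyps n :
  [/\ forall t u v, Phi_rep n.+1 (t - u) v = Phi_rep n.+1 t v - Phi_rep n.+1 u v,
      forall t v w, Phi_rep n.+1 t (v + w) = Phi_rep n.+1 t v + Phi_rep n.+1 t w,
      forall (t : T) s v, Phi_rep n.+1 (t * s%:A) v = Phi_rep n.+1 t (s *: v)
    & forall (t : T) v, IA t -> span (filtQ n) (Phi_rep n.+1 t v)].
Proof.
split=> [t u v|t v w|t s v|t v tI].
- by rewrite -sumrB; apply: eq_bigr => j _; rewrite raddfB mulrBl.
- by rewrite -big_split; apply: eq_bigr => j _; rewrite raddfD mulrDr.
- apply: eq_bigr => j _; rewrite linearZ /=.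
  have := thomMr (n.+1 - j) t (@tdeg_scalar _ V s); rewrite addn0 => ->.
  by rewrite -mul_scalar_t.
apply: span_sum => j _; apply: (@IA_filt_mul n (n.+1 - j) j) => //.
- by rewrite subnK // -ltnS.
- exact: tdeg_thom.
- exact: IA_thom.
Qed.

Lemma Phi_pure n (t : T) v : Phi n (piA t ⊗ v) = span_pi (filtQ n) (Phi_rep n.+1 t v).
Proof. by case: (Phi_hyps n) => h1 h2 h3 h4; exact: tens_lift_pure. Qed.
Lemma PhiB n x y : Phi n (x - y) = Phi n x - Phi n y.
Proof. by case: (Phi_hyps n) => h1 h2 h3 h4; exact: tens_liftB. Qed.
Lemma Phi0 n : Phi n 0 = 0.
Proof. by rewrite -(subrr 0) PhiB subrr. Qed.

Lemma Phi_hom n i j (t : T) v : tdeg i t -> grmod_deg M2 j v ->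
  Phi n (piA t ⊗ v) = if (i + j == n.+1)%N then span_pi (filtQ n) (t * G j v) else 0.
Proof.
move=> ti vj; rewrite Phi_pure; have [ni|ni] := leqP i n.+1; last first.
  by rewrite (Phi_rep_gt _ ti) // raddf0 gtn_eqF // (leq_trans ni) ?leq_addr.
rewrite (Phi_rep_hom _ ti) //; case: eqP => [ijn|/eqP ijn].
  by rewrite -ijn addKn.
rewrite (G_eq0 vj) ?mulr0 ?raddf0 //; apply: contraNneq ijn => <-.
by rewrite subnKC.
Qed.

Lemma Phi_deg m n x : deg2 m x -> m != n.+1 -> Phi n x = 0.
Proof.
move=> xm mn; elim/(tens_deg_ind strA): xm => [|y z y0 z0|i j t v ijm ti vj].
- exact: Phi0.
- by rewrite PhiB y0 z0 subr0.
by rewrite (Phi_hom _ ti vj) ijm (negPf mn).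
Qed.

Lemma kappa_D1 i j (t : T) v : tdeg i t -> grmod_deg M2 j v ->
  kappa (i + j) (D1 (piA t ⊗ v)) = span_pi IAV (t * thom j (G j v)).
Proof.
move=> ti vj; rewrite -{1}[piA t]mulr1 -pure_scale D1Z.
by apply: kappa_scale => //; exact: G_symbol.
Qed.

(** One lift f of x serves for all v. This brings [Phi] of a product v x, of degree n + 1, back to
    an element of F_n whose symbol is known from [D1 x]. *)
Lemma Phi_lift n x : deg2 n x -> exists f,
  [/\ filt n f, kappa n (D1 x) = span_pi IAV (thom n f)
    & forall v : V, Phi n (deg1_val v *: x) = span_pi (filtQ n) (iota_t v * f)].
Proof.
elim/(tens_deg_ind strA) => [|y z [f [fn ky Py]] [g [gn kz Pz]]|i j t v ijn ti vj].
- exists 0; rewrite !raddf0 kappa0; split=> [||v] //; first exact: filt0.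
  by rewrite scaler0 Phi0 mulr0 raddf0.
- exists (f - g); rewrite !raddfB kappaB ky kz; split=> // [|v]; first exact: filtB.
  by rewrite scalerBr PhiB Py Pz mulrBr raddfB.
exists (t * G j v); split=> [||w].
- by rewrite -ijn; exact: filtMl.
- by rewrite -ijn (kappa_D1 ti vj) (thomMl _ _ ti).
rewrite pure_scale -piA_iota -piAM (Phi_hom _ (tdegM (tdeg_iota w) ti) vj).
by rewrite -addnA ijn eqxx mulrA.
Qed.

Lemma genG_lift n f : span (genG n.+1) f -> exists x,
  [/\ deg2 n.+1 x, kappa n.+1 (D1 x) = span_pi IAV (thom n.+1 f)
    & Phi n x = span_pi (filtQ n) f].
Proof.
elim=> [_ [i [j [t [v [ijn ti ->]]]]]||f1 f2 _ [x [xn kx Px]] _ [y [yn ky Py]]].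
- have vj := gcomp_deg (@grmod_grading _ M2) v j.
  exists (piA t ⊗ comp v j); rewrite (Phi_hom _ ti vj) ijn eqxx G_comp.
  rewrite -ijn (kappa_D1 ti vj) G_comp (thomMl _ _ ti); split=> //.
  exact: (tens_deg_pure ti vj).
- by exists 0; rewrite !raddf0 kappa0 Phi0; split=> //; exact: span_0.
- exists (x - y); rewrite !raddfB /= kappaB PhiB kx ky Px Py; split=> //.
  exact: span_B.
Qed.

(** Here x is arbitrary, because exactness yields preimages without control of their degree;
    [kappa n] discards the components of other degrees. *)
Lemma D1_genG n x :
  exists f, span (genG n) f /\ kappa n (D1 x) = span_pi IAV (thom n f).
Proof.
elim/(tens_hom_ind strA): x => [|x y [f [fn xf]] [g [gn yg]]|i j t v ti vj].
- by exists 0; rewrite !raddf0 kappa0; split=> //; exact: span_0.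
- by exists (f - g); rewrite !raddfB /= kappaB xf yg; split=> //; exact: span_B.
have [ijn|ijn] := eqVneq (i + j)%N n.
  exists (t * G j v); rewrite -ijn (kappa_D1 ti vj) (thomMl _ _ ti); split=> //.
  by apply: span_gen; exists i, j, t, v.
exists 0; rewrite !raddf0; split; first exact: span_0.
apply: (kappa_eq0 _ _ ijn); apply: D1_deg.
exact: (tens_deg_pure ti vj).
Qed.

Lemma filt_gens_dec n y : span (filt_gens R alpha n) y -> IA_dec (thom n.+1 y : tA A).
Proof.
apply: (span_map (f := @thom S V n.+1)) => z [zn|[v [f [fn ->]]]|[v [f [fn ->]]]] /=.
- by rewrite (iffLR (tdeg_leP _ _) (filt_le filR zn)) //; exact: span_0.
- apply: span_gen; exists (iota_t v), (thom n f); split;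
  [exact: tdeg_iota|exact: (filt_symbol relR filR)|left].
  by rewrite -add1n (thomMl _ _ (tdeg_iota v)).
- apply: span_gen; exists (iota_t v), (thom n f); split;
  [exact: tdeg_iota|exact: (filt_symbol relR filR)|right].
  by rewrite -addn1 (thomMr _ _ (tdeg_iota v)).
Qed.

Lemma IAV_dec y : span IAV y -> IA_dec (y : tA A).
Proof.
apply: span_sub => _ [u [v [uI ->]]]; apply: span_gen.
by exists (iota_t v), u; split=> //; [exact: tdeg_iota|right].
Qed.

Definition filtQG n : set T := [set y | filtQ n y \/ genG n.+1 y].

(** Only the products v f call for the induction: f is decomposed one degree lower, and v is
    absorbed on the left of every term. *)
Lemma filt_gens_QG n y : (forall m x, n = m.+1 -> filt n x -> span (filtQG m) x) ->
  span (filt_gens R alpha n) y -> span (filtQG n) y.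
Proof.
move=> IH; apply: span_sub => z [zn|[v [f [fn ->]]]|[v [f [fn ->]]]].
- by apply: span_gen; left; left.
- case: n IH fn => [_ /(filt_0 relR filR) ->|n /(_ n f erefl) IH /IH].
    by rewrite mulr0; exact: span_0.
  apply: span_mull => {}z [[zn|[g [w [gn ->]]]]|[i [j [t [w [ijn ti ->]]]]]];
    apply: span_gen.
  + by left; left; exact: filt_vM.
  + by left; right; exists (iota_t v * g), w; rewrite mulrA; split=> //; exact: filt_vM.
  + right; exists i.+1, j, (iota_t v * t), w; rewrite mulrA addSn ijn; split=> //.
    exact: (tdegM (tdeg_iota v) ti).
- by apply: span_gen; left; right; exists f, v.
Qed.

(* The generators deform(r) are recovered from those of the form t G_j(v)
   because r is determined by its class modulo V I + I V. *)
Lemma filt_QG_step n : (forall m x, n = m.+1 -> filt n x -> span (filtQG m) x) ->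
  forall x, filt n.+1 x -> span (filtQG n) x.
Proof.
move=> /filt_gens_QG QG x /(filt_decompose relR filR)[r [y [Rr rn /QG yQG ->]]].
apply: span_D yQG.
(* The class of r in A ⊗ V is a cycle, as r is in I, hence a boundary [D1 z]; so r agrees modulo I V
   with the symbol of a combination f of the generators. *)
have [y0 [ky0 D0y0]] := kappa_ex strA D0E rn.
have [z zy0] : exists z, D1 z = y0 by apply/D01; rewrite D0y0; exact: (rel_IA relR Rr).
have [f [fG kf]] := D1_genG n.+1 z.
have fr : span IAV (thom n.+1 f - r) by apply/span_pi_eq; rewrite -kf zy0.
have [r' [y' [Rr' r'n y'n fE]]] := filt_decompose relR filR (genG_filt fG).
have rr' : r' - r = 0.
  have [_ _ _] := relR; apply; first exact: submodB.
  have -> : r' - r = (thom n.+1 f - r) - thom n.+1 y'.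
    by rewrite fE raddfD /= (thom_deform _ r'n) addrAC addrK.
  by apply: span_B; [exact: IAV_dec|exact: filt_gens_dec].
have -> : deform alpha n.+1 r = f - y' by rewrite fE -(subr0_eq rr') addrK.
by apply: span_B; [apply: span_sub fG => w wG; apply: span_gen; right|exact: QG].
Qed.

Lemma filt_QG n x : filt n.+1 x -> span (filtQG n) x.
Proof.
elim: n x => [|n IH] x; last first.
  by apply: filt_QG_step => m {}x [<-]; exact: IH.
by apply: filt_QG_step.
Qed.

Variable m : nat.
Hypothesis M3_le : forall j v, (m < j)%N -> grmod_deg M3 j v -> v = 0.

(* Since M3 has no generator of degree n+1, a syzygy of degree n+1 is a sum of
   products w x with w in V and x a syzygy of degree n. The lift f of such an x
   has its symbol in I V, so f is in F_{n-1} + F_{n-1} V by regularity in degree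
   n-1. *)
Lemma Phi_D2 n : (m <= n)%N -> (forall k, n = k.+1 -> filt_reg R alpha k) ->
  forall x, Phi n (D2 x) = 0.
Proof.
move=> mn regn; elim/(tens_hom_ind strA) => [|x y x0 y0|i j t v ti vj].
- by rewrite raddf0 Phi0.
- by rewrite raddfB PhiB x0 y0 subr0.
have [ijn|ijn] := eqVneq (i + j)%N n.+1; last first.
  by apply: (Phi_deg _ ijn); exact/D2_deg/(tens_deg_pure ti vj).
(* For i = 0 the generator v itself has degree n + 1 > m, hence is zero. *)
case: i ti ijn => [|i] ti ijn.
  have -> : v = 0 by apply: M3_le vj; rewrite -[j]add0n ijn ltnS.
  by rewrite pure0r raddf0 Phi0.
elim: (tdegSl ti) => [_ [w [u [ui ->]]]||t1 t2 _ t10 _ t20].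
- rewrite piAM piA_iota -pure_scale D2Z.
  move: ijn; rewrite addSn => -[ijn].
  have un : deg3 n (piA u ⊗ v) by rewrite -ijn; exact: (tens_deg_pure ui vj).
  have [f [fn kf ->]] := Phi_lift (D2_deg un); apply/span_pi0.
  have fI : span IAV (thom n f).
    by apply/span_pi0; rewrite -kf (_ : D1 _ = 0) ?kappa0 //; apply/D12; eexists.
  case: n mn regn ijn un fn kf fI => [|n] mn regn ijn un fn kf fI.
    by rewrite (filt_0 relR filR fn) mulr0; exact: span_0.
  have [z [zV zf]] := IAV_lift n fI; rewrite -[f](subrK z) mulrDr.
  apply: span_D.
    apply/filtQ_filt/filt_vM; apply: regn => //.
      by apply: filtB => //; exact: filtV_filt.
    have := filtB fn (filtV_filt zV) => /(filt_le filR)/tdeg_leP fz.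
    apply/tdeg_leP => k; rewrite leq_eqVlt => /orP[/eqP <-|/fz//].
    by rewrite raddfB /= zf (thom_id (@tdeg_thom _ _ _ _)) subrr.
  apply: filtQ_V; apply: span_mull zV => _ [g [a [gn ->]]]; apply: span_gen.
  by exists (iota_t w * g), a; rewrite mulrA; split=> //; exact: filt_vM.
- by rewrite raddf0 pure0l raddf0 Phi0.
- by rewrite raddfB /= pureBl raddfB PhiB t10 t20 subr0.
Qed.

(** The premise on k is regularity in degree n - 1; for n = 0 it is empty, D having no part of
    degree -1. *)
Lemma filt_reg_step n : (m <= n)%N -> (forall k, n = k.+1 -> filt_reg R alpha k) ->
  filt_reg R alpha n.
Proof.
move=> mn regn x xS xn.
have [q [f [qn fn xE]]] :
    exists q f, [/\ span (filtQ n) q, span (genG n.+1) f & x = q + f].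
  elim: (filt_QG xS) => [z [zQ|zG]||y z _ [q [f [qn fn ->]]] _ [q' [f' [qn' fn' ->]]]].
  - by exists z, 0; rewrite addr0; split=> //; [exact: span_gen|exact: span_0].
  - by exists 0, z; rewrite add0r; split=> //; [exact: span_0|exact: span_gen].
  - by exists 0, 0; rewrite addr0; split=> //; exact: span_0.
  - by exists (q - q'), (f - f'); rewrite opprD addrACA; split=> //; exact: span_B.
have [y [yn ky Py]] := genG_lift fn.
have fI : span IAV (thom n.+1 f).
  have -> : thom n.+1 f = - thom n.+1 q.
    have := iffLR (tdeg_leP _ _) xn n.+1 (ltnSn n).
    by rewrite xE raddfD /= addrC => /eqP; rewrite addr_eq0 => /eqP.
  exact/span_N/filtQ_IAV.
(* [D1 y] is homogeneous of degree n + 1, where [kappa] is injective, and the symbol of f lies in I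
   V. *)
have D1y : D1 y = 0.
  have [_ [_ _ _]] := kappa_homP strA D0E projV (D1_deg yn).
  by apply; rewrite ky; apply/span_pi0.
have [z zy] := iffRL (D12 y) D1y.
have fQ : span (filtQ n) f by apply/span_pi0; rewrite -Py -zy; exact: Phi_D2.
have [g [w [gn wV xgw]]] : exists g w, [/\ filt n g, span (filtV n) w & x = g + w].
  by apply: filtQP; rewrite xE; exact: span_D.
(* The remainder w = x - g lies in F_n V and has degree at most n, so the flatness argument
   applies. *)
rewrite xgw; apply: filtD => //; apply: filtV_le => //.
by rewrite -[w](addKr g) -xgw addrC; apply: tdeg_leB => //; exact: filt_le gn.
Qed.

End Generators.

(** Below m regularity is assumed; from m on it climbs one degree at a time, each step using only
    the preceding degree. *)
Lemma regular_of_bound m :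
  (forall j v, (m < j)%N -> grmod_deg M3 j v -> v = 0) ->
  (forall n, (n < m)%N -> filt_reg R alpha n) -> ext_regular R alpha.
Proof.
move=> M3m regm; have [G [GF GS G0 Gc]] := filt_lift.
apply: (ext_regularP relR filR); elim=> [|n IH].
  have [m0|m0] := ltnP 0 m; first exact: regm.
  exact: (filt_reg_step GF GS G0 Gc M3m).
have [nm|mn] := ltnP n.+1 m; first exact: regm.
by apply: (filt_reg_step GF GS G0 Gc M3m) => // k [<-].
Qed.

End Differentials.
End Regularity.

Theorem theorem4p15 (S : nzRingType) (A : conn_ring S) (R : submod (tA A))
    (V : nat -> grmod S)
    (d : forall n, {linear res_obj A V n.+1 -> res_obj A V n})
    (alpha : tA A -> tA A) :
  strongly_graded A ->
  relation_bimodule R ->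
  projective (sub_of R) ->
  projective (deg1 A) ->
  is_resolution d ->
  filtered_morphism R alpha ->
  ext_regular R alpha <->
  complexity (V 3%N) = (-1)%:E \/
  ext_n_regular R alpha (complexity (V 3%N)).
Proof.
move=> strA relR _ projV res filR; split=> [reg|].
  by right; case: complexity => [n||] //= a az _; exact: reg.
have [resP _ resD resD0 _ resE] := res.
have regP := regular_of_bound strA relR filR projV (resP 2%N isT)
  resD0 (resD 1%N) (resD 2%N) (resE 0%N) (resE 1%N).
rewrite /complexity; case: pselect => [V0 _|nV0].
  by apply: (regP 0%N) => // j v _ _; exact: V0.
(* If V_3 is unbounded the complexity is infinite, and the hypothesis is regularity itself. *)
case: pselect => [bnd|nbnd]; last by case.
(* When the least bound is 0 the complexity is again -1, and the range n < 0 of degrees to be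
   assumed regular is empty. *)
case: ex_minnP => m /asboolP V0 _; case: m V0 => [|m] V0.
  by move=> _; apply: (regP 0%N) => // j v j0 vj; exact: (V0 j).
(* V_3 vanishes above degree m + 1, so its complexity is m, and m-regularity covers exactly the
   degrees n < m + 1. *)
rewrite /= (_ : m.+1%:Z - 1 = m%:Z); last by rewrite -addn1 PoszD addrK.
move=> -[//|regm].
apply: (regP m.+1) => [j v mj|n]; first exact: V0.
by rewrite ltnS => nm; exact: (filt_reg_ext relR filR nm).
Qed.
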